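(* Let $\mathcal{A}$ be a unital $C^*$-algebra and let $\{f_n\}_{n\in\mathbb{N}}\subseteq H_{\mathcal{A}}$ be a Bessel sequence. Then $\{f_n\}_{n\in\mathbb{N}}$ is a pseudo-Riesz-Weyl sequence if and only if the associated synthesis operator $\Theta^*$ is upper semi-$\mathcal{A}$-Weyl.
   Context: $\mathcal{A}$ is a unital $C^*$-algebra and $H_{\mathcal{A}}$ is the standard Hilbert $\mathcal{A}$-module: sequences $(a_i)_{i\ge 1}$ in $\mathcal{A}$ with $\sum_i a_ia_i^*$ norm-convergent, left $\mathcal{A}$-action, inner product $\langle a,b\rangle=\sum_i a_ib_i^*$, and standard orthonormal basis $\{e_i\}_{i\in\mathbb{N}}$, where $\mathbb{N}=\{1,2,\dots\}$. $L_n\cong\mathcal{A}^n$ is the submodule of sequences $(x_i)$ with $x_i=0$ for $i>n$. $B^a(H_{\mathcal{A}})$ is the algebra of bounded adjointable $\mathcal{A}$-linear operators on $H_{\mathcal{A}}$. $M=M_1\tilde\oplus M_2$ means that $M_1,M_2$ are closed submodules of $M$ with $M_1\cap M_2=\{0\}$ and $M_1+M_2=M$ (not necessarily orthogonal). $(\cdot)^\perp$ is the orthogonal complement in $H_{\mathcal{A}}$. An isomorphism of Hilbert modules is a bounded $\mathcal{A}$-linear bijection with bounded inverse. $N\preceq N'$ means that $N$ is isomorphic to a closed submodule of $N'$. Finitely generated means algebraically finitely generated over $\mathcal{A}$. Bessel sequence: a sequence $\{f_n\}$ in a Hilbert $\mathcal{A}$-module $\mathcal X$ such that for some constant $M>0$,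 $\sum_n\langle x,f_n\rangle\langle f_n,x\rangle\le M\langle x,x\rangle$ for all $x\in\mathcal X$, the sum converging in norm. Its synthesis operator is $\Theta^*:H_{\mathcal{A}}\to\mathcal X$, $\Theta^*(c)=\sum_n c_nf_n$ for $c=(c_n)\in H_{\mathcal{A}}$ (so $\Theta^*(e_n)=f_n$); it is the adjoint of the analysis operator $\Theta(x)=\sum_n\langle x,f_n\rangle e_n$. Modular Riesz basis: a sequence $\{y_i\}_{i\ge1}$ in a countably generated Hilbert $\mathcal{A}$-module $\mathcal X$ is a modular Riesz basis for $\mathcal X$ if the $\mathcal{A}$-linear operator from $H_{\mathcal{A}}$ onto $\mathcal X$ mapping $e_i$ to $y_i$ for every $i$ is invertible and adjointable. A tail $\{f_n\}_{n=m+1}^\infty$ is regarded as the sequence $y_i=f_{m+i}$. Pseudo-Riesz-Weyl sequence: a Bessel sequence $\{f_n\}_{n\in\mathbb{N}}\subseteq H_{\mathcal{A}}$ for which there is $m\in\mathbb{N}$ such that $\{f_n\}_{n=m+1}^\infty$ is a modular Riesz basis for $\overline{\operatorname{Span}_{\mathcal{A}}\{f_n\mid n\ge m+1\}}$ and $L_m\preceq\left(\overline{\operatorname{Span}_{\mathcal{A}}\{f_n\mid n\ge m+1\}}\right)^{\perp}$. Upper semi-$\mathcal{A}$-Weyl: $F\in B^a(H_{\mathcal{A}})$ for which there are decompositions $H_{\mathcal{A}}=M_1\tilde\oplus N_1$ and $H_{\mathcal{A}}=M_2\tilde\oplus N_2$ into closed submodules with $F(M_1)\subseteq M_2$, $F(N_1)\subseteq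 N_2$, $F|_{M_1}:M_1\to M_2$ an isomorphism, $N_1$ finitely generated, and $N_1\preceq N_2$. *)

(* Defs.v *)
From HB Require Import structures.
From mathcomp Require Import all_boot all_order all_algebra.
From mathcomp Require Import complex.
From mathcomp Require Import all_classical all_reals all_analysis.

Set Implicit Arguments.
Unset Strict Implicit.
Unset Printing Implicit Defensive.

Import Order.TTheory GRing.Theory Num.Theory.
Import numFieldNormedType.Exports.

Local Open Scope classical_set_scope.
Local Open Scope ring_scope.

(* HB refuses a structure joining the normed modules over R[i] with the rings,
   because [numDomainType] already joins them (with the ring as its own base), so
   the product is part of the mixin and the ring structure is declared as an
   instance below. [1 != 0] is not required: the zero algebra is allowed. *)
HB.mixin Record CompleteNormedModule_isCStarAlgebra (R : realType) A
    of CompleteNormedModule R[i] A := {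
  cstar_one : A ;
  cstar_mul : A -> A -> A ;
  star : A -> A ;
  cstar_mulA : associative cstar_mul ;
  cstar_mul1 : left_id cstar_one cstar_mul ;
  cstar_mulr1 : right_id cstar_one cstar_mul ;
  cstar_mulDl : left_distributive cstar_mul +%R ;
  cstar_mulDr : right_distributive cstar_mul +%R ;
  cstar_scalerAl : forall (k : R[i]) (x y : A),
    k *: cstar_mul x y = cstar_mul (k *: x) y ;
  cstar_scalerAr : forall (k : R[i]) (x y : A),
    k *: cstar_mul x y = cstar_mul x (k *: y) ;
  starK : involutive star ;
  starD : {morph star : x y / x + y} ;
  starZ : forall (k : R[i]) (x : A), star (k *: x) = k^* *: star x ;
  starM : forall x y : A, star (cstar_mul x y) = cstar_mul (star y) (star x) ;
  cstar_normM : forall x y : A, `|cstar_mul x y| <= `|x| * `|y| ;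
  cstar_norm : forall x : A, `|cstar_mul (star x) x| = `|x| ^+ 2
}.

#[short(type="cstarAlgType")]
HB.structure Definition CStarAlgebra (R : realType) :=
  {A of CompleteNormedModule R[i] A & CompleteNormedModule_isCStarAlgebra R A}.

HB.instance Definition _ (R : realType) (A : cstarAlgType R) :=
  GRing.Zmodule_isPzRing.Build A (@cstar_mulA R A) (@cstar_mul1 R A)
    (@cstar_mulr1 R A) (@cstar_mulDl R A) (@cstar_mulDr R A).

Section StandardModule.
Context {R : realType} {A : cstarAlgType R}.

(* Sequences are indexed from 0: the index i of [nat] is the index i + 1 of the
   mathematical text. Modules are represented by sets of sequences, and an
   operator defined on a module M by a total function [(nat -> A) -> (nat -> A)]
   of which only the values on M matter. *)
Implicit Types (x y c : nat -> A) (u f : nat -> nat -> A).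
Implicit Types (S M N X : set (nat -> A)).
Implicit Types (F T : (nat -> A) -> (nat -> A)).

Definition cstar_le (a b : A) : Prop := exists d : A, b - a = star d * d.

Definition HA : set (nat -> A) :=
  [set x | cvgn (series (fun i => x i * star (x i)))].

Definition hinner x y : A := limn (series (fun i => x i * star (y i))).

(* The norm of A takes its (nonnegative real) values in R[i]. *)
Definition hnorm x : R := Num.sqrt (complex.Re `|hinner x x|).

Definition hscale (a : A) x : nat -> A := fun i => a * x i.

Definition hbasis (i : nat) : nat -> A := fun j => (j == i)%:R.

Definition Lsub (n : nat) : set (nat -> A) :=
  [set x | HA x /\ forall i, (n <= i)%N -> x i = 0].

(* Closure in HA for the norm topology. *)
Definition hclosure S : set (nat -> A) :=
  [set x | HA x /\
    forall e : R, 0 < e -> exists2 y, S y & hnorm (x - y) < e].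

Definition submodule M : Prop :=
  [/\ M `<=` HA, M 0, forall x y, M x -> M y -> M (x + y) &
      forall (a : A) x, M x -> M (hscale a x)].

Definition closed_submodule M : Prop := submodule M /\ hclosure M `<=` M.

Definition hspan u : set (nat -> A) :=
  [set x | exists (n : nat) (c : nat -> A),
     x = \sum_(i < n) hscale (c i) (u i)].

Definition horth S : set (nat -> A) :=
  [set x | HA x /\ forall y, S y -> hinner x y = 0].

Definition finitely_generated M : Prop :=
  exists (n : nat) (g : 'I_n -> nat -> A), (forall i, M (g i)) /\
    forall x, M x -> exists c : 'I_n -> A, x = \sum_(i < n) hscale (c i) (g i).

Definition direct_sum M M1 M2 : Prop :=
  [/\ closed_submodule M1, closed_submodule M2, M1 `&` M2 = [set 0] &
      [set x + y | x in M1 & y in M2] = M].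

Definition Alinear_on M T : Prop :=
  (forall x y, M x -> M y -> T (x + y) = T x + T y) /\
  (forall (a : A) x, M x -> T (hscale a x) = hscale a (T x)).

Definition bounded_on M T : Prop :=
  exists K : R, forall x, M x -> hnorm (T x) <= K * hnorm x.

Definition adjointable M N T : Prop :=
  exists T' : (nat -> A) -> (nat -> A), (forall y, N y -> M (T' y)) /\
    forall x y, M x -> N y -> hinner (T x) y = hinner x (T' y).

(* B^a(HA) *)
Definition Ba F : Prop :=
  [/\ forall x, HA x -> HA (F x), Alinear_on HA F, bounded_on HA F &
      adjointable HA HA F].

Definition module_iso M N T : Prop :=
  [/\ forall x, M x -> N (T x), Alinear_on M T, bounded_on M T &
      exists T' : (nat -> A) -> (nat -> A),
        [/\ forall y, N y -> M (T' y), bounded_on N T',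
            forall x, M x -> T' (T x) = x & forall y, N y -> T (T' y) = y]].

Definition subisomorphic N N' : Prop :=
  exists P : set (nat -> A), [/\ closed_submodule P, P `<=` N' &
    exists T, module_iso N P T].

Definition bessel f : Prop :=
  (forall n, HA (f n)) /\
  exists K : R, 0 < K /\ forall x, HA x ->
    let s := series (fun n => hinner x (f n) * hinner (f n) x) in
    cvgn s /\ cstar_le (limn s) (K%:C%C *: hinner x x).

Definition is_hsum u x : Prop :=
  HA x /\ hnorm (x - \sum_(i < n) u i) @[n --> \oo] --> (0 : R).

(* The limit is unique when it exists; the default value 0 is never relevant for
   the synthesis operator of a Bessel sequence on HA. *)
Definition hsum u : nat -> A := xget 0 (is_hsum u).

Definition synthesis f c : nat -> A := hsum (fun n => hscale (c n) (f n)).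

Definition modular_riesz_basis u X : Prop :=
  exists T, [/\ module_iso HA X T, adjointable HA X T &
                forall i, T (hbasis i) = u i].

Definition tail (m : nat) f : nat -> nat -> A := fun i => f (m + i)%N.

Definition pseudo_riesz_weyl f : Prop :=
  bessel f /\ exists m : nat,
    let X := hclosure (hspan (tail m f)) in
    [/\ (0 < m)%N, modular_riesz_basis (tail m f) X &
        subisomorphic (Lsub m) (horth X)].

Definition upper_semi_weyl F : Prop :=
  Ba F /\ exists M1 N1 M2 N2 : set (nat -> A),
    [/\ direct_sum HA M1 N1, direct_sum HA M2 N2 &
      [/\ forall x, M1 x -> M2 (F x), forall x, N1 x -> N2 (F x),
          module_iso M1 M2 F, finitely_generated N1 & subisomorphic N1 N2]].

End StandardModule.

(* Main.v *)
Require Import Defs.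
From mathcomp Require Import all_boot all_order all_algebra complex.
From mathcomp Require Import all_classical all_reals all_analysis.
From mathcomp Require Import lra ring.

(** Write F for the synthesis operator of f, H for the standard module, L_m for
    its first m coordinates and X for the closed span of a tail of f. Since F maps
    the m-th shift of e_i to f_{m+i}, the tail is a modular Riesz basis of X
    exactly when F is bounded below on L_m^perp, and then X = F(L_m^perp).

    From Riesz to Weyl (synthesis_upper_semi_weyl): X is orthogonally
    complemented, and the decompositions H = L_m^perp + F^{-1}(X^perp) and
    H = X + X^perp witness that F is upper semi-Weyl.

    From Weyl to Riesz (upper_semi_weyl_pseudo_riesz): the finitely generated N1
    is orthogonally complemented; let p be the orthogonal projection onto N1 and
    J the embedding of N1 into N2. The operator E = F (1 - p) + J p is bounded
    below on H. As p has finitely many coefficients, it is uniformly small on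
    L_k^perp for large k, where therefore F is close to E. This yields
    |E l - F x| >= c |l - x| for l in L_k and x in L_k^perp
    (perturbed_lower_bound). The case l = 0 makes the tail a Riesz basis of
    X = F(L_k^perp), and the general case says that E, followed by the projection
    onto X^perp, embeds L_k into X^perp.

    Two facts of Hilbert module theory carry this. A closed range is orthogonally
    complemented (closed_range_complemented); here this is obtained by a
    continuity method applied to S S^* on the range of S. Bounded inverses come
    from completeness through a Baire category argument for closed linear
    relations (closed_relation_bounded), which serves both for preimages under an
    operator with closed range and for the components of a direct sum.

    Beneath lies the order of a C*-algebra: positivity of x x^* and monotonicity
    of the norm on positive elements, from which the Cauchy-Schwarz inequality
    follows. Both are derived without spectral theory, from square roots given
    by an iteration and from the unitaries h + i sqrt(1 - h^2). *)

Set Implicit Arguments.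
Unset Strict Implicit.
Unset Printing Implicit Defensive.
Import Order.TTheory GRing.Theory Num.Theory.
Import numFieldNormedType.Exports.
Local Open Scope classical_set_scope.
Local Open Scope ring_scope.

Notation "t *:R x" := (t%:C%C *: x) (at level 40) : ring_scope.

(** * Real norm and limits in a C*-algebra *)

Section CStarNorm.
Context {R : realType} {A : cstarAlgType R}.
Implicit Types (a b c x y z : A) (s t r e : R) (u v : nat -> A).

Definition nrm a : R := complex.Re `|a|.

Lemma nrmE a : `|a| = (nrm a)%:C%C.
Proof. by rewrite /nrm RRe_real // ger0_real. Qed.

Lemma nrm_ge0 a : 0 <= nrm a.
Proof. by rewrite -lecR -nrmE normr_ge0. Qed.

Lemma nrm_le a t : (nrm a <= t) = (`|a| <= t%:C%C).
Proof. by rewrite nrmE lecR. Qed.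

Lemma nrm0 : nrm (0 : A) = 0.
Proof. by rewrite /nrm normr0. Qed.

Lemma nrm0_eq0 a : nrm a = 0 -> a = 0.
Proof. by move=> h; apply/normr0_eq0; rewrite nrmE h. Qed.

Lemma nrmD a b : nrm (a + b) <= nrm a + nrm b.
Proof. by rewrite -lecR rmorphD /= -!nrmE ler_normD. Qed.

Lemma nrmN a : nrm (- a) = nrm a.
Proof. by rewrite /nrm normrN. Qed.

Lemma nrmB a b : nrm (a - b) <= nrm a + nrm b.
Proof. by rewrite -(nrmN b) nrmD. Qed.

Lemma nrm_distC a b : nrm (a - b) = nrm (b - a).
Proof. by rewrite -nrmN opprB. Qed.

Lemma nrm_dist3 a b c : nrm (a - b) <= nrm (a - c) + nrm (c - b).
Proof. by rewrite -[a - b](subrKA c) nrmD. Qed.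

Lemma nrmM a b : nrm (a * b) <= nrm a * nrm b.
Proof. by rewrite -lecR rmorphM /= -!nrmE; exact: cstar_normM. Qed.

Lemma nrmZ t a : nrm (t *:R a) = `|t| * nrm a.
Proof.
apply: complexI; rewrite -nrmE normrZ [RHS]rmorphM /= nrmE; congr (_ * _).
by rewrite normc_def /= expr0n addr0 sqrtr_sqr.
Qed.

Lemma scaleAl (k : R[i]) a b : k *: (a * b) = (k *: a) * b.
Proof. exact: cstar_scalerAl. Qed.

Lemma scaleAr (k : R[i]) a b : k *: (a * b) = a * (k *: b).
Proof. exact: cstar_scalerAr. Qed.

Lemma scaleRA s t a : s *:R (t *:R a) = (s * t) *:R a.
Proof. by rewrite scalerA rmorphM. Qed.

Lemma scaleRDl s t a : (s + t) *:R a = s *:R a + t *:R a.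
Proof. by rewrite rmorphD scalerDl. Qed.

Lemma scaleR1 a : 1 *:R a = a.
Proof. by rewrite scale1r. Qed.

Lemma scaleR2 a : 2 *:R a = a + a.
Proof. by rewrite -[2]/(1 + 1) scaleRDl scaleR1. Qed.

Lemma starB a b : star (a - b) = star a - star b.
Proof.
have star0 : star (0 : A) = 0.
  by apply: (addrI (star 0)); rewrite -starD !addr0.
have starN c : star (- c) = - star c.
  by apply/eqP; rewrite -addr_eq0 -starD addNr star0.
by rewrite starD starN.
Qed.

Lemma star0 : star (0 : A) = 0.
Proof. by rewrite -[in LHS](subrr 0) starB subrr. Qed.

Lemma starN a : star (- a) = - star a.
Proof. by rewrite -[in LHS](sub0r a) starB star0 sub0r. Qed.

Lemma starMr a b : star (a * b) = star b * star a.
Proof. exact: starM. Qed.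

Lemma star1 : star (1 : A) = 1.
Proof. by rewrite -[LHS]mulr1 -[in X in _ * X](starK 1) -starMr mulr1 starK. Qed.

Lemma starZR t a : star (t *:R a) = t *:R star a.
Proof. by rewrite starZ conj_Creal // complex_real. Qed.

Lemma starZi a : star ('i *: a) = - ('i *: star a).
Proof. by rewrite starZ conjCi scaleNr. Qed.

Lemma nrm_ss a : nrm (star a * a) = nrm a ^+ 2.
Proof. by apply: complexI; rewrite -nrmE rmorphXn /= -nrmE; exact: cstar_norm. Qed.

Lemma nrm_star a : nrm (star a) = nrm a.
Proof.
suff le b : nrm b <= nrm (star b).
  by apply/le_anti; rewrite le andbT -{2}(starK a) le.
have := nrm_ge0 b; rewrite le_eqVlt => /orP[/eqP <-|b0]; first exact: nrm_ge0.
by rewrite -(ler_pM2r b0) -expr2 -nrm_ss nrmM.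
Qed.

Lemma nrm_sr a : nrm (a * star a) = nrm a ^+ 2.
Proof. by rewrite -{1}(starK a) nrm_ss nrm_star. Qed.

Lemma nrm_sa a : star a = a -> nrm (a * a) = nrm a ^+ 2.
Proof. by move=> sa; rewrite -{1}sa nrm_ss. Qed.

Lemma nrm1 : nrm (1 : A) <= 1.
Proof.
have := nrm_sa star1; rewrite mulr1 => h.
have := nrm_ge0 1; rewrite le_eqVlt => /orP[/eqP <- //|p].
by rewrite -(ler_pM2r p) -expr2 -h mul1r.
Qed.

Lemma nrm_scale1 t : 0 <= t -> nrm (t *:R (1 : A)) <= t.
Proof.
by move=> t0; rewrite nrmZ ger0_norm// -{2}(mulr1 t) ler_wpM2l// nrm1.
Qed.

(** The topology of A is indexed by radii in R[i]; the estimates below are made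
    with radii in R. *)
Definition alim u a : Prop :=
  forall e, 0 < e -> exists N, forall n, (N <= n)%N -> nrm (a - u n) <= e.

Lemma alimP u a : alim u a <-> u n @[n --> \oo] --> a.
Proof.
split => [h|/cvgrPdist_le h e e0].
  apply/cvgrPdist_le => e e0.
  have eE : e = (complex.Re e)%:C%C by rewrite RRe_real // gtr0_real.
  have e0' : 0 < complex.Re e by rewrite -ltcR -eE.
  have [N hN] := h _ e0'; exists N => // n /= /hN.
  by rewrite nrm_le -eE.
have e0' : 0 < e%:C%C by rewrite ltcR.
have [N _ hN] := h _ e0'; exists N => n Nn.
by rewrite nrm_le; exact: (hN n).
Qed.

Lemma alim_cauchy u :
  (forall e, 0 < e -> exists N, forall m n, (N <= m)%N -> (m <= n)%N ->
     nrm (u n - u m) <= e) -> exists a, alim u a.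
Proof.
move=> h.
have /cauchy_cvgP c : cauchy (u n @[n --> \oo]).
  apply/cauchyP => e e0.
  have eE : e = (complex.Re e)%:C%C by rewrite RRe_real // gtr0_real.
  have e0' : 0 < complex.Re e / 2 by rewrite divr_gt0// -ltcR -eE.
  have [N hN] := h _ e0'; exists (u N); exists N => // n /= Nn.
  rewrite -ball_normE /= distrC nrmE eE ltcR.
  apply: le_lt_trans (hN _ _ (leqnn N) Nn) _.
  by move: e0'; lra.
by exists (limn u); apply/alimP.
Qed.

Lemma alim_const a : alim (fun=> a) a.
Proof. by move=> e e0; exists 0%N => n _; rewrite subrr nrm0 ltW. Qed.

Lemma alim_le u a c t : alim u a -> (forall n, nrm (c - u n) <= t) -> nrm (c - a) <= t.
Proof.
move=> h ht; apply/ler_addgt0Pr => e /h[N /(_ N (leqnn N)) hN].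
apply: le_trans (nrm_dist3 _ _ (u N)) _.
by rewrite lerD// nrm_distC.
Qed.

Lemma alim_unique u a b : alim u a -> alim u b -> a = b.
Proof. by move=> /alimP ua /alimP; exact: cvg_unique. Qed.

Lemma alimD u v a b : alim u a -> alim v b -> alim (fun n => u n + v n) (a + b).
Proof. by move=> /alimP ua /alimP vb; apply/alimP; exact: cvgD. Qed.

Lemma alim_bounded_op (f : A -> A) (K : R) u a :
  (forall x y, nrm (f x - f y) <= K * nrm (x - y)) ->
  alim u a -> alim (f \o u) (f a).
Proof.
move=> fK ua e e0.
have e1 : 0 < e / (`|K| + 1) by rewrite divr_gt0// ltr_wpDl.
have [N hN] := ua _ e1; exists N => n /hN h /=.
apply: le_trans (fK _ _) _.
have := nrm_ge0 (a - u n); have := ler_norm K; have := normr_ge0 K.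
have K1 : 0 < `|K| + 1 by rewrite ltr_wpDl.
move: h; rewrite ler_pdivlMr// mulrC => h k0 k1 n0.
by apply: le_trans h; apply: ler_wpM2r => //; lra.
Qed.

Lemma alimMl c u a : alim u a -> alim (fun n => c * u n) (c * a).
Proof.
apply: (@alim_bounded_op (fun x => c * x) (nrm c)) => x y.
by rewrite -mulrBr nrmM.
Qed.

Lemma alimMr c u a : alim u a -> alim (fun n => u n * c) (a * c).
Proof.
apply: (@alim_bounded_op (fun x => x * c) (nrm c)) => x y.
by rewrite -mulrBl mulrC nrmM.
Qed.

Lemma alim_star u a : alim u a -> alim (fun n => star (u n)) (star a).
Proof.
apply: (@alim_bounded_op (fun x => star x) 1) => x y.
by rewrite mul1r -starB nrm_star.
Qed.

Lemma alimZ t u a : alim u a -> alim (fun n => t *:R u n) (t *:R a).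
Proof.
apply: (@alim_bounded_op (fun x => t *:R x) `|t|) => x y.
by rewrite -scalerBr nrmZ.
Qed.

End CStarNorm.

(** * Positive elements *)

Section SquareRoot.
Context {R : realType} {A : cstarAlgType R}.
Implicit Types (a b c x y z : A) (s t r e : R) (u v : nat -> A).

(** A fixed point y of y = (b + y^2) / 2 satisfies (1 - y)^2 = 1 - b. The scalar
    iteration, at b = 1, dominates the one in A: it bounds both the terms and
    their increments, and it converges even at the boundary |b| = 1. *)
Definition sqrt_dom : nat -> R := fix u n :=
  if n is m.+1 then (1 + u m ^+ 2) / 2 else 0.

Definition sqrt_iter b : nat -> A := fix y n :=
  if n is m.+1 then 2^-1 *:R (b + y m * y m) else 0.

Lemma sqrt_dom01 n : 0 <= sqrt_dom n <= 1.
Proof. by elim: n => [|n /andP[h0 h1]] /=; rewrite ?lexx ?ler01//; apply/andP; nra. Qed.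

Lemma sqrt_domS n : sqrt_dom n <= sqrt_dom n.+1.
Proof.
have /andP[h0 h1] := sqrt_dom01 n.
by rewrite /= ler_pdivlMr//; nra.
Qed.

Lemma sqrt_iter_bound b n : nrm b <= 1 -> nrm (sqrt_iter b n) <= sqrt_dom n.
Proof.
move=> b1; elim: n => [|n ih] /=; first by rewrite nrm0.
rewrite nrmZ ger0_norm ?invr_ge0// mulrC ler_pM2r ?invr_gt0//.
apply: le_trans (nrmD _ _) _; rewrite lerD//.
apply: le_trans (nrmM _ _) _; rewrite -expr2 ler_pXn2r// ?nnegrE ?nrm_ge0//.
by have /andP[] := sqrt_dom01 n.
Qed.

Lemma sqrt_iter_step b n : nrm b <= 1 ->
  nrm (sqrt_iter b n.+1 - sqrt_iter b n) <= sqrt_dom n.+1 - sqrt_dom n.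
Proof.
move=> b1; elim: n => [|n ih].
  rewrite /= subr0 subr0 nrmZ mulr0 addr0 expr0n addr0 mul1r.
  by rewrite ger0_norm ?invr_ge0// ler_piMr ?invr_ge0.
set p := sqrt_iter b n.+1 in ih *; set q := sqrt_iter b n in ih *.
set s := sqrt_dom n.+1 in ih *; set t := sqrt_dom n in ih *.
have -> : sqrt_iter b n.+2 - p = 2^-1 *:R (p * (p - q) + (p - q) * q).
  by rewrite /= -/p {2}/p /= -/q -scalerBr opprD addrACA subrr add0r mulrBr mulrBl subrKA.
have -> : sqrt_dom n.+2 - s = 2^-1 * ((s + t) * (s - t)).
  have sE : s = (1 + t ^+ 2) / 2 by [].
  by rewrite -[sqrt_dom n.+2]/((1 + s ^+ 2) / 2); move: sE; lra.
rewrite nrmZ ger0_norm ?invr_ge0// ler_pM2l ?invr_gt0//.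
have hp : nrm p <= s by exact: sqrt_iter_bound.
have hq : nrm q <= t by exact: sqrt_iter_bound.
apply: le_trans (nrmD _ _) _.
have := nrmM p (p - q); have := nrmM (p - q) q.
have := nrm_ge0 (p - q); have := nrm_ge0 p; have := nrm_ge0 q.
nra.
Qed.

Lemma sqrt_iter_comm b z n : z * b = b * z -> z * sqrt_iter b n = sqrt_iter b n * z.
Proof.
move=> zb; elim: n => [|n ih] /=; first by rewrite mulr0 mul0r.
by rewrite -scaleAl -scaleAr mulrDl mulrDr zb mulrA ih -mulrA ih mulrA.
Qed.

Lemma sqrt_iter_sa b n : star b = b -> star (sqrt_iter b n) = sqrt_iter b n.
Proof. by move=> sb; elim: n => [|n ih] /=; rewrite ?star0// starZR starD starMr sb ih. Qed.

(** The iterates form a Cauchy sequence because their increments are dominated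
    by those of a bounded monotone real sequence; selfadjointness and commutation
    pass from the iterates to the limit. *)
Lemma sqrt_exists b : star b = b -> nrm b <= 1 ->
  exists s : A, [/\ star s = s, s * s = 1 - b, nrm (1 - s) <= 1 &
    forall z, z * b = b * z -> z * s = s * z].
Proof.
move=> sb b1.
have step m n : (m <= n)%N ->
    nrm (sqrt_iter b n - sqrt_iter b m) <= sqrt_dom n - sqrt_dom m.
  move=> /subnK <-; elim: (n - m)%N => [|k ih]; first by rewrite !subrr nrm0.
  rewrite addSn; apply: le_trans (nrm_dist3 _ _ (sqrt_iter b (k + m))) _.
  have -> : sqrt_dom (k + m).+1 - sqrt_dom m =
    (sqrt_dom (k + m).+1 - sqrt_dom (k + m)) + (sqrt_dom (k + m) - sqrt_dom m).
    by rewrite subrKA.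
  by rewrite lerD// sqrt_iter_step.
have nd : {homo sqrt_dom : n m / (n <= m)%N >-> n <= m}.
  by apply/nondecreasing_seqP => n; exact: sqrt_domS.
have cv : cvgn sqrt_dom.
  apply: nondecreasing_is_cvgn => //; exists 1 => _ [n _ <-].
  by have /andP[] := sqrt_dom01 n.
have [y hy] : exists y, alim (sqrt_iter b) y.
  apply: alim_cauchy => e e0.
  move/cvgrPdist_le: (cv) => /(_ e e0)[N _ hN]; exists N => m n Nm mn.
  apply: le_trans (step _ _ mn) _.
  have := hN m Nm; rewrite /= ger0_norm ?subr_ge0; last exact: nondecreasing_cvgn_le.
  by apply: le_trans; rewrite lerB//; exact: nondecreasing_cvgn_le.
have y1 : nrm y <= 1.
  rewrite -nrmN -sub0r; apply: alim_le hy _ => n; rewrite sub0r nrmN.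
  by apply: le_trans (sqrt_iter_bound n b1) _; have /andP[] := sqrt_dom01 n.
have yc z : z * b = b * z -> z * y = y * z.
  move=> zb; apply: alim_unique (alimMl z hy) _.
  rewrite (_ : (fun n => _) = (fun n => sqrt_iter b n * z)); first exact: alimMr.
  by apply/funext => n; rewrite sqrt_iter_comm.
have sy : star y = y.
  apply: alim_unique (alim_star hy) _.
  by rewrite (_ : (fun n => _) = sqrt_iter b)//; apply/funext => n; rewrite sqrt_iter_sa.
(* the fixed point equation of the iteration *)
have fy : 2^-1 *:R (b + y * y) = y.
  apply/esym; apply: (@alim_unique _ _ (fun n => sqrt_iter b n.+1)).
    by move=> e /hy[N hN]; exists N => n Nn; apply: hN; rewrite leqW.
  rewrite /=; apply: alimZ; apply: alimD; first exact: alim_const.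
  move=> e e0; have [N hN] := hy _ (divr_gt0 e0 (ltr0n R 2)).
  exists N => n /hN h; set q := sqrt_iter b n in h *.
  have -> : y * y - q * q = y * (y - q) + (y - q) * q.
    by rewrite mulrBr mulrBl subrKA.
  have hq : nrm q <= 1.
    by apply: le_trans (sqrt_iter_bound n b1) _; have /andP[] := sqrt_dom01 n.
  apply: le_trans (nrmD _ _) _.
  have := nrmM y (y - q); have := nrmM (y - q) q.
  have := nrm_ge0 (y - q); have := nrm_ge0 y; have := nrm_ge0 q.
  nra.
exists (1 - y); split.
- by rewrite starB star1 sy.
- have : y + y = b + y * y by rewrite -scaleR2 -{1}fy scaleRA divff ?pnatr_eq0// scaleR1.
  move=> h; have -> : b = y + y - y * y by rewrite h addrK.
  by rewrite mulrBl mul1r mulrBr mulr1 !opprB addrACA -opprD addrA.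
- by rewrite opprB addrC subrK.
- by move=> z zb; rewrite mulrBl mulrBr mulr1 mul1r yc.
Qed.

(** The spectrum of a selfadjoint a lies in [0, 2t] exactly when |t - a| <= t.
    In this form sums of positive elements are positive by the triangle
    inequality. *)
Definition pos a : Prop :=
  star a = a /\ exists2 t : R, 0 <= t & nrm (t *:R (1 : A) - a) <= t.

End SquareRoot.
Section PositiveCone.
Context {R : realType} {A : cstarAlgType R}.
Implicit Types (a b c h s w x y z : A) (t r e : R) (u v : nat -> A).

(** When h^2 + w^2 is a scalar, u = h + iw is a multiple of a unitary, and norm
    estimates for h and h^2 - w^2 follow from those for u. *)
Lemma cartesian_mul h w : star h = h -> star w = w -> h * w = w * h ->
  let u := h + 'i *: w : A in
  [/\ star u = h - 'i *: w, u * star u = h * h + w * w,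
      u * u + star u * star u = 2 *:R (h * h - w * w) &
      u + star u = 2 *:R h].
Proof.
move=> sh sw hw u.
have su : star u = h - 'i *: w by rewrite starD starZi sh sw.
have ii (z : A) : 'i *: ('i *: z) = - z by rewrite scalerA -expr2 sqrCi scaleN1r.
split => //; rewrite su ?scaleR2 /u.
- rewrite mulrDl !mulrBr -!scaleAl -!scaleAr ii hw opprK.
  by rewrite addrA subrK.
- set k := 'i *: (w * h).
  have -> : (h + 'i *: w) * (h + 'i *: w) = h * h - w * w + (k + k).
    by rewrite mulrDl !mulrDr -!scaleAl -!scaleAr ii hw -/k [k - _]addrC addrACA.
  have -> : (h - 'i *: w) * (h - 'i *: w) = h * h - w * w - (k + k).
    rewrite mulrBl !mulrBr -!scaleAl -!scaleAr ii hw -/k.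
    by rewrite opprB addrACA -opprD.
  by rewrite addrACA subrr addr0.
- by rewrite addrACA subrr addr0.
Qed.

Lemma nrm_normal h w : star h = h -> star w = w -> h * w = w * h ->
  nrm (h : A) ^+ 2 <= nrm (h * h + w * w).
Proof.
move=> sh sw hw; have [su uu _ uD] := cartesian_mul sh sw hw.
rewrite -uu nrm_sr ler_pXn2r ?nnegrE ?nrm_ge0//.
set u := h + _ in su uu uD *.
have : nrm (u + star u) <= nrm u + nrm u by rewrite -{2}(nrm_star u) nrmD.
by rewrite uD nrmZ ger0_norm//; lra.
Qed.

(** With w a square root of 1 - h^2 commuting with h, the element u = h + iw is
    unitary and 1 - h^2 = 1/2 - (u^2 + u^*^2)/4, of norm at most 1. *)
Lemma nrm_one_sub_sq h : star h = h -> nrm (h : A) <= 1 -> nrm (1 - h * h) <= 1.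
Proof.
move=> sh h1.
have sb : star (h * h) = h * h by rewrite starMr sh.
have b1 : nrm (h * h) <= 1 by rewrite nrm_sa// expr_le1// nrm_ge0.
have [w [sw ww _ wc]] := sqrt_exists sb b1.
have hw : h * w = w * h by apply: wc; rewrite mulrA.
have [su uu u2 _] := cartesian_mul sh sw hw.
set u := h + _ in su uu u2 *.
have n1 : nrm u <= 1.
  by rewrite -(@ler_pXn2r _ 2) ?nnegrE ?nrm_ge0// expr1n -nrm_sr uu ww addrC subrK nrm1.
have -> : 1 - h * h = 4^-1 *:R (2 *:R (1 : A) - (u * u + star u * star u)).
  rewrite u2 -scalerBr ww opprB addrCA -scaleR2 !scaleRA.
  by rewrite (_ : 4^-1 * 2 * 2 = 1 :> R) ?scaleR1// -mulrA -natrM mulVf ?pnatr_eq0.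
rewrite nrmZ ger0_norm ?invr_ge0//.
have := nrmB (2 *:R (1 : A)) (u * u + star u * star u).
have := nrmD (u * u) (star u * star u).
have := nrmM u u; have := nrmM (star u) (star u); rewrite nrm_star.
have := @nrm_scale1 R A 2 (ler0n _ _); have := nrm_ge0 u; nra.
Qed.

Lemma nrm_sub_sq s r : star s = s -> nrm (s * s : A) <= r ->
  nrm (r *:R (1 : A) - s * s) <= r.
Proof.
move=> ss; have := nrm_ge0 (s * s) => n0 nr.
have := le_trans n0 nr; rewrite le_eqVlt => /orP[/eqP r0|r0].
  have -> : s * s = 0 by apply: nrm0_eq0; apply/le_anti; rewrite n0 r0 nr.
  by rewrite subr0 -r0 nrmZ normr0 mul0r.
set q := Num.sqrt r.
have q0 : 0 < q by rewrite sqrtr_gt0.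
have qq : q ^+ 2 = r by rewrite sqr_sqrtr// ltW.
set h := q^-1 *:R s.
have sh : star h = h by rewrite starZR ss.
have hh : h * h = r^-1 *:R (s * s).
  by rewrite -scaleAl -scaleAr scaleRA -qq -invfM -expr2.
have h1 : nrm h <= 1.
  rewrite -(@ler_pXn2r _ 2) ?nnegrE ?nrm_ge0// expr1n -nrm_sa// hh nrmZ.
  by rewrite gtr0_norm ?invr_gt0// ler_pdivrMl// mulr1.
have := nrm_one_sub_sq sh h1; rewrite hh.
have -> : r *:R (1 : A) - s * s = r *:R (1 - r^-1 *:R (s * s)).
  by rewrite scalerBr scaleRA divff ?scaleR1// gt_eqF.
by move=> h2; rewrite nrmZ gtr0_norm// ler_piMr// ltW.
Qed.

Lemma pos_sq s : star s = s -> pos (s * s : A).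
Proof.
move=> ss; split; first by rewrite starMr ss.
by exists (nrm (s * s)); [exact: nrm_ge0 | exact: nrm_sub_sq].
Qed.

Lemma posZ t a : 0 <= t -> pos a -> pos (t *:R a).
Proof.
move=> t0 [sa [r r0 hr]]; split; first by rewrite starZR sa.
exists (t * r); first by rewrite mulr_ge0.
by rewrite -scaleRA -scalerBr nrmZ ger0_norm// ler_wpM2l.
Qed.

Lemma pos_sqrt a : pos a ->
  exists s : A, [/\ pos s, s * s = a & forall z, z * a = a * z -> z * s = s * z].
Proof.
move=> [sa [t0 t00 ht0]].
(* replacing t0 by t0 + 1 makes it positive *)
have [t t_gt0 ht] : exists2 t : R, 0 < t & nrm (t *:R (1 : A) - a) <= t.
  exists (t0 + 1); first by rewrite ltr_wpDl.
  rewrite scaleRDl addrAC; apply: le_trans (nrmD _ _) _.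
  by rewrite lerD// scaleR1 nrm1.
have tE x : t *:R (t^-1 *:R x) = x by rewrite scaleRA divff ?scaleR1// gt_eqF.
set b := 1 - t^-1 *:R a.
have sb : star b = b by rewrite starB star1 starZR sa.
have b1 : nrm b <= 1.
  rewrite -(ler_pM2l t_gt0) mulr1 -[X in X * _]gtr0_norm// -nrmZ.
  by rewrite /b scalerBr tE.
have [s [ss s2 s1 sc]] := sqrt_exists sb b1.
exists (Num.sqrt t *:R s); split.
- apply: posZ; rewrite ?sqrtr_ge0//; split => //.
  by exists 1 => //; rewrite scaleR1.
- rewrite -scaleAl -scaleAr scaleRA -expr2 sqr_sqrtr ?(ltW t_gt0)// s2.
  by rewrite opprB addrC subrK tE.
- move=> z za; rewrite -scaleAl -scaleAr sc// /b mulrBr mulrBl mulr1 mul1r.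
  by rewrite -scaleAl -scaleAr za.
Qed.

Lemma pos_nrm_sub a r : pos a -> nrm a <= r -> nrm (r *:R (1 : A) - a) <= r.
Proof. by move=> /pos_sqrt[s [[ss _] <- _]]; exact: nrm_sub_sq. Qed.

Lemma pos0 : pos (0 : A).
Proof. by split; [exact: star0 | exists 0 => //; rewrite scale0r subr0 nrm0]. Qed.

Lemma posD a b : pos a -> pos b -> pos (a + b).
Proof.
move=> [sa [t t0 ht]] [sb [r r0 hr]]; split; first by rewrite starD sa sb.
exists (t + r); first by rewrite addr_ge0.
by rewrite scaleRDl opprD addrACA; apply: le_trans (nrmD _ _) _; rewrite lerD.
Qed.

Lemma pos_sub_nrm a r : star a = a -> nrm a <= r -> pos (r *:R (1 : A) - a).
Proof.
move=> sa ar; split; first by rewrite starB starZR star1 sa.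
by exists r; [exact: le_trans (nrm_ge0 a) ar | rewrite opprB addrC subrK].
Qed.

(** Commuting square roots s of a and w of r - a give a normal element s + iw of
    squared norm r, whose selfadjoint part is s. *)
Lemma pos_le_nrm a r : 0 <= r -> pos a -> pos (r *:R (1 : A) - a) -> nrm a <= r.
Proof.
move=> r0 /pos_sqrt[s [[ss _] <- _]] /pos_sqrt[w [[sw _] ww wc]].
have sw' : s * w = w * s.
  by apply: wc; rewrite mulrBr mulrBl -scaleAl -scaleAr mulr1 mul1r mulrA.
rewrite nrm_sa//; apply: le_trans (nrm_normal ss sw sw') _.
by rewrite ww addrC subrK nrm_scale1.
Qed.

Lemma pos_nrm_mono a b : pos a -> pos b -> nrm a <= nrm (a + b).
Proof.
move=> pa pb; have pc := posD pa pb.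
apply: pos_le_nrm => //; first exact: nrm_ge0.
have -> : nrm (a + b) *:R (1 : A) - a = (nrm (a + b) *:R (1 : A) - (a + b)) + b.
  by rewrite opprD addrA subrK.
by apply: posD => //; apply: pos_sub_nrm => //; exact: pc.1.
Qed.

Lemma pos_lim u a t : (forall n, pos (u n)) -> (forall n, nrm (u n) <= t) ->
  alim u a -> pos a.
Proof.
move=> pu ut ua; split.
  apply: (alim_unique (alim_star ua)).
  by rewrite (_ : (fun n => _) = u)//; apply/funext => n; rewrite (pu n).1.
exists t; first exact: le_trans (nrm_ge0 _) (ut 0%N).
by apply: alim_le ua _ => n; exact: pos_nrm_sub.
Qed.

End PositiveCone.
Section Kaplansky.
Context {R : realType} {A : cstarAlgType R}.
Implicit Types (a b c h p q s w x y z : A) (t r e : R) (u v : nat -> A).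

Lemma sa_sq_eq0 h : star h = h -> h * h = 0 -> h = 0.
Proof.
move=> sh hh; apply/nrm0_eq0/eqP.
by have := nrm_sa sh; rewrite hh nrm0 => /esym/eqP; rewrite expf_eq0.
Qed.

(** With r = |y|^2, the element c = y (y^* (r - y y^* ) y) y^* = r p^2 + p^3 has
    norm at most r^3, because |r - y^* y| <= r; but p <= r gives c >= 2 p^3,
    whose norm is 2 r^3. *)
Lemma pos_neg_eq0 y : pos (star y * y) -> pos (- (y * star y)) -> y = 0.
Proof.
set q := star y * y; set p := - _ => pq pp.
have yy : y * star y = - p by rewrite opprK.
set r := nrm y ^+ 2.
have nq : nrm q = r by rewrite nrm_ss.
have np : nrm p = r by rewrite nrmN nrm_sr.
have r0 : 0 <= r by rewrite sqr_ge0.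
have [w [[sw _] ww wc]] := pos_sqrt pp.
have pr : pos (r *:R (1 : A) - p) by apply: pos_sub_nrm; rewrite ?np//; exact: pp.1.
have [v [[sv _] vv vc]] := pos_sqrt pr.
have pw : p * w = w * p by exact: wc.
have pv : p * v = v * p.
  by apply: vc; rewrite mulrBl mulrBr -scaleAl -scaleAr mul1r mulr1.
have sqE (g : A) : p * g = g * p -> (p * g) * (p * g) = p * (g * g) * p.
  by move=> pu; rewrite {2}pu !mulrA.
have p3 : pos (p * p * p).
  rewrite (_ : p * p * p = (p * w) * (p * w)).
    by apply: pos_sq; rewrite starMr sw pp.1 pw.
  by rewrite sqE// ww.
set c := r *:R (p * p) + p * p * p.
have cp : c = 2 *:R (p * p * p) + (p * v) * (p * v).
  rewrite sqE// vv mulrBr mulrBl -scaleAr -scaleAl mulr1.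
  by rewrite scaleR2 addrC addrA subrK.
have cy : c = y * (q * (r *:R (1 : A) - q)) * star y.
  rewrite mulrBr -scaleAr mulr1 mulrBr mulrBl -scaleAr -scaleAl.
  have -> : y * q * star y = p * p.
    by rewrite /q !mulrA yy -mulrA yy mulrNN.
  have -> : y * (q * q) * star y = - (p * p * p).
    rewrite /q !mulrA yy -[- p * y * star y]mulrA yy.
    by rewrite -[_ * y * star y]mulrA yy mulrNN mulrN.
  by rewrite opprK.
have n1 : nrm c <= r * (r * r).
  rewrite cy; apply: le_trans (nrmM _ _) _; rewrite nrm_star.
  have h1 := nrmM y (q * (r *:R (1 : A) - q)); have h2 := nrmM q (r *:R (1 : A) - q).
  have h3 : nrm (r *:R (1 : A) - q) <= r by apply: pos_nrm_sub; rewrite ?nq.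
  have h4 : nrm (q * (r *:R (1 : A) - q)) <= r * r.
    by apply: le_trans h2 _; rewrite nq ler_wpM2l.
  apply: (@le_trans _ _ (nrm y * (r * r) * nrm y)).
    by rewrite ler_wpM2r ?nrm_ge0//; apply: le_trans h1 _; rewrite ler_wpM2l ?nrm_ge0.
  by rewrite mulrAC -expr2.
have n2 : 2 * nrm (p * p * p) <= nrm c.
  have -> : 2 * nrm (p * p * p) = nrm (2 *:R (p * p * p)).
    by rewrite nrmZ ger0_norm.
  rewrite cp; apply: pos_nrm_mono; first exact: posZ.
  by apply: pos_sq; rewrite starMr sv pp.1 pv.
have n3 : r ^+ 4 <= nrm (p * p * p) * r.
  rewrite -{2}np; apply: le_trans (nrmM _ _).
  rewrite -[p * p * p * p]mulrA nrm_sa ?starMr ?pp.1// nrm_sa ?pp.1// np.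
  by rewrite -exprM.
have r4 : r ^+ 4 = 0 by have := exprn_ge0 4 r0; nra.
apply/nrm0_eq0/eqP; move/eqP: r4.
by rewrite !expf_eq0.
Qed.

(** If a = x x^* and b = |a|, then z = b - a is twice the negative part of a,
    and y = z x has y y^* = z a z = - z b z <= 0. Since y^* y + y y^* is a sum
    of two squares of selfadjoint elements, y^* y >= 0, so y = 0, and then
    z = 0. *)
Lemma pos_sr x : pos (x * star x).
Proof.
set a := x * star x.
have sa : star a = a by rewrite starMr starK.
have [b [pb bb bc]] := pos_sqrt (pos_sq sa).
have ab : a * b = b * a by apply: bc; rewrite mulrA.
set z := b - a.
have sz : star z = z by rewrite starB pb.1 sa.
have [w [[sw _] ww wc]] := pos_sqrt pb.
have zb : z * b = b * z by rewrite mulrBl mulrBr ab.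
have zw : z * w = w * z by exact: wc.
have az : a * z = - (b * z) by rewrite !mulrBr -bb ab opprB.
have zz : z * z = 2 *:R (b * z) by rewrite {1}/z mulrBl az opprK scaleR2.
have zbz : z * (b * z) = (w * z) * (w * z).
  by rewrite -ww -!mulrA mulrA zw -mulrA; congr (w * _); rewrite mulrA zw mulrA.
have swz : star (w * z) = w * z by rewrite starMr sw sz zw.
set y := z * x.
have yy : y * star y = - (z * (b * z)).
  by rewrite /y starMr sz -mulrA [x * _]mulrA az mulrN.
have py : pos (star y * y).
  have -> : star y * y = 2^-1 *:R ((y + star y) * (y + star y) +
      ('i *: (y - star y)) * ('i *: (y - star y)) + 2 *:R (- (y * star y))).
    have ii (g : A) : 'i *: ('i *: g) = - g by rewrite scalerA -expr2 sqrCi scaleN1r.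
    rewrite -scaleAl -scaleAr ii.
    set k := y * star y; set l := star y * y.
    have -> : (y + star y) * (y + star y) = (y * y + star y * star y) + (k + l).
      by rewrite mulrDl !mulrDr [l + _]addrC addrACA.
    have -> : (y - star y) * (y - star y) = (y * y + star y * star y) - (k + l).
      by rewrite mulrBl !mulrBr opprB addrACA -opprD.
    rewrite opprB [k + l - _]addrC addrACA subrr add0r -scaleR2 -scalerDr.
    by rewrite addrAC subrr add0r scaleRA mulVf ?pnatr_eq0// scaleR1.
  apply: posZ; rewrite ?invr_ge0//; apply: posD; first apply: posD.
  - by apply: pos_sq; rewrite starD starK addrC.
  - by apply: pos_sq; rewrite starZi starB starK -scalerN opprB.
  - by apply: posZ; rewrite // yy opprK zbz; exact: pos_sq.
have y0 : y = 0 by apply: pos_neg_eq0 => //; rewrite yy opprK zbz; exact: pos_sq.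
have wz0 : w * z = 0.
  by apply: sa_sq_eq0 => //; rewrite -zbz -[LHS]opprK -yy y0 mul0r oppr0.
have z0 : z = 0 by apply: sa_sq_eq0 => //; rewrite zz -ww -mulrA wz0 mulr0 scaler0.
by move/eqP: z0; rewrite subr_eq0 => /eqP <-.
Qed.

Lemma pos_ss x : pos (star x * x).
Proof. by rewrite -{2}(starK x); exact: pos_sr. Qed.

Lemma pos_conj x a : pos a -> pos (x * a * star x).
Proof.
move=> /pos_sqrt[s [[ss _] <- _]].
by rewrite (_ : _ * _ = (x * s) * star (x * s)); [exact: pos_sr | rewrite starMr ss !mulrA].
Qed.

Lemma cstar_leP a b : cstar_le a b <-> pos (b - a).
Proof.
split => [[d ->]|/pos_sqrt[s [[ss _] sE _]]]; first exact: pos_ss.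
by exists s; rewrite ss sE.
Qed.

Lemma pos_sub_mono a b : pos a -> pos (b - a) -> nrm a <= nrm b.
Proof. by move=> pa pba; rewrite -[b](subrK a) addrC pos_nrm_mono. Qed.

(** Here p, a, q stand for <x,x>, <x,y>, <y,y>, and the hypothesis is the
    positivity of <x - by, x - by>; the choice b = a / r with r > |q| gives
    a a^* <= r p. *)
Lemma cauchy_schwarz_abstract p q a : pos q ->
  (forall b, pos (p - b * star a - a * star b + b * q * star b)) ->
  nrm a ^+ 2 <= nrm p * nrm q.
Proof.
move=> pq h; apply/ler_addgt0Pr => e e0.
have np1 : 0 < nrm p + 1 by rewrite ltr_wpDl// nrm_ge0.
set r := nrm q + e / (nrm p + 1).
have r0 : 0 < r by rewrite ltr_wpDl ?nrm_ge0// divr_gt0.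
suff : nrm a ^+ 2 <= r * nrm p.
  move=> /le_trans; apply.
  rewrite /r mulrDl mulrC lerD2l -mulrA ler_piMr ?(ltW e0)// ler_pdivrMl// mulr1.
  by rewrite lerDl.
rewrite -ler_pdivrMl// -nrm_sr.
have -> : r^-1 * nrm (a * star a) = nrm (r^-1 *:R (a * star a)).
  by rewrite nrmZ gtr0_norm// invr_gt0.
apply: pos_sub_mono; first by apply: posZ; [rewrite invr_ge0 ltW | exact: pos_sr].
have -> : p - r^-1 *:R (a * star a) =
   (p - (r^-1 *:R a) * star a - a * star (r^-1 *:R a) +
      (r^-1 *:R a) * q * star (r^-1 *:R a)) +
   (r^-1 * r^-1) *:R (a * (r *:R (1 : A) - q) * star a).
  have -> : (r^-1 *:R a) * star a = r^-1 *:R (a * star a) by rewrite scaleAl.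
  have -> : a * star (r^-1 *:R a) = r^-1 *:R (a * star a) by rewrite starZR scaleAr.
  have -> : (r^-1 *:R a) * q * star (r^-1 *:R a) = (r^-1 * r^-1) *:R (a * q * star a).
    by rewrite starZR -!scaleAl -scaleAr scaleRA.
  have -> : a * (r *:R (1 : A) - q) * star a = r *:R (a * star a) - a * q * star a.
    by rewrite mulrBr mulrBl -scaleAr -scaleAl mulr1.
  rewrite scalerBr scaleRA (_ : r^-1 * r^-1 * r = r^-1); last first.
    by rewrite -mulrA mulVf ?mulr1// gt_eqF.
  by rewrite -[RHS]addrA [X in _ = _ + X]addrC !subrK.
apply: posD => //; apply: posZ; first by rewrite mulr_ge0 // invr_ge0 ltW.
apply: pos_conj; apply: pos_sub_nrm; first exact: pq.1.
by rewrite lerDl divr_ge0// ltW.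
Qed.

End Kaplansky.

(** * The standard Hilbert module *)

Section StandardModule.
Context {R : realType} {A : cstarAlgType R}.
Implicit Types (a b c : A) (t r e : R) (u v x y z : nat -> A).

Lemma summableP u : cvgn (series u) <-> forall e, 0 < e ->
  exists N, forall m n, (N <= m)%N -> (m <= n)%N -> nrm (\sum_(m <= i < n) u i) <= e.
Proof.
split => [/alimP h e e0|h].
  have [N hN] := h _ (divr_gt0 e0 (ltr0n R 2)); exists N => m n Nm mn.
  rewrite -sub_series_geq//; apply: le_trans (nrm_dist3 _ _ (limn (series u))) _.
  rewrite nrm_distC; have := hN m Nm; have := hN n (leq_trans Nm mn); lra.
suff [l /alimP] : exists l, alim (series u) l by move/cvgP.
apply: alim_cauchy => e /h[N hN]; exists N => m n Nm mn.
by rewrite sub_series_geq//; exact: hN.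
Qed.

Lemma pos_sum m n (F : nat -> A) : (forall i, pos (F i)) -> pos (\sum_(m <= i < n) F i).
Proof.
move=> h; elim/big_ind: _ => //; first exact: pos0.
by move=> a b; exact: posD.
Qed.

Lemma star_sum m n (F : nat -> A) :
  star (\sum_(m <= i < n) F i) = \sum_(m <= i < n) star (F i).
Proof.
elim/big_rec2: _ => [|i a b _ <-]; first exact: star0.
by rewrite starD.
Qed.

(** Stated for blocks of coordinates, so that it yields the Cauchy criterion for
    the series of <x,y>. *)
Lemma cauchy_schwarz_sum m n x y :
  nrm (\sum_(m <= i < n) x i * star (y i)) ^+ 2 <=
  nrm (\sum_(m <= i < n) x i * star (x i)) * nrm (\sum_(m <= i < n) y i * star (y i)).
Proof.
apply: cauchy_schwarz_abstract => [|b]; first by apply: pos_sum => i; exact: pos_sr.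
rewrite star_sum !mulr_sumr !mulr_suml.
rewrite -!sumrB -big_split /=; apply: pos_sum => i.
rewrite (_ : _ + _ = (x i - b * y i) * star (x i - b * y i)); first exact: pos_sr.
rewrite starB !starMr starK mulrBl !mulrBr !mulrA opprB.
by rewrite [RHS]addrA [RHS]addrAC; congr (_ + _); exact: addrAC.
Qed.

Lemma hinner_cvg x y : HA x -> HA y -> alim (series (fun i => x i * star (y i))) (hinner x y).
Proof.
move=> hx hy; apply/alimP; apply: (_ : cvgn _); apply/summableP => e e0.
have [N1 h1] := (summableP _).1 hx _ e0; have [N2 h2] := (summableP _).1 hy _ e0.
exists (maxn N1 N2) => m n; rewrite geq_max => /andP[m1 m2] mn.
have := cauchy_schwarz_sum m n x y; have := h1 m n m1 mn; have := h2 m n m2 mn.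
set p := nrm _; set q := nrm _; set s := nrm _ => hp hq h.
rewrite -(@ler_pXn2r _ 2) ?nnegrE ?nrm_ge0 ?(ltW e0)//; apply: le_trans h _.
by rewrite expr2 ler_pM// nrm_ge0.
Qed.

Lemma hinner_eq x y a : HA x -> HA y ->
  alim (series (fun i => x i * star (y i))) a -> hinner x y = a.
Proof. by move=> hx hy; apply: alim_unique; exact: hinner_cvg. Qed.

Lemma HA_alim x a : alim (series (fun i => x i * star (x i))) a -> HA x.
Proof. by move/alimP => h; apply: cvgP h. Qed.

Lemma seriesD u v : series (fun i => u i + v i) = (fun n => series u n + series v n).
Proof. by apply/funext => n; rewrite /series /= big_split. Qed.

Lemma seqDE x y i : (x + y) i = x i + y i.
Proof. by []. Qed.

Lemma seqNE x i : (- x) i = - x i.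
Proof. by []. Qed.

Lemma HAD x y : HA x -> HA y -> HA (x + y).
Proof.
move=> hx hy; apply: (@HA_alim _ (hinner x x + hinner x y + (hinner y x + hinner y y))).
rewrite (_ : (fun i => _) = (fun i => (x i * star (x i) + x i * star (y i)) +
    (y i * star (x i) + y i * star (y i)))); last first.
  by apply/funext => i; rewrite -mulrDr -mulrDr -mulrDl -starD.
rewrite !seriesD; apply: alimD; apply: alimD; exact: hinner_cvg.
Qed.

Lemma hinnerDl x y z : HA x -> HA y -> HA z -> hinner (x + y) z = hinner x z + hinner y z.
Proof.
move=> hx hy hz; apply: hinner_eq => //; first exact: HAD.
rewrite (_ : (fun i => _) = (fun i => x i * star (z i) + y i * star (z i))); last first.
  by apply/funext => i; rewrite -mulrDl.
by rewrite seriesD; apply: alimD; exact: hinner_cvg.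
Qed.

Lemma hinnerC x y : HA x -> HA y -> star (hinner x y) = hinner y x.
Proof.
move=> hx hy; apply/esym/hinner_eq => //.
rewrite (_ : series _ = fun n => star (series (fun i => x i * star (y i)) n)).
  by apply: alim_star; exact: hinner_cvg.
apply/funext => n; rewrite /series /= star_sum; apply: eq_bigr => i _.
by rewrite starMr starK.
Qed.

Lemma hinnerDr x y z : HA x -> HA y -> HA z -> hinner x (y + z) = hinner x y + hinner x z.
Proof.
move=> hx hy hz; rewrite -hinnerC ?hinnerDl ?starD ?hinnerC//; exact: HAD.
Qed.

Lemma seriesMl a u : series (fun i => a * u i) = (fun n => a * series u n).
Proof. by apply/funext => n; rewrite /series /= mulr_sumr. Qed.

Lemma HAZ a x : HA x -> HA (hscale a x).
Proof.
move=> hx; apply: (@HA_alim _ (a * hinner x x * star a)).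
rewrite (_ : series _ = fun n => (a * series (fun i => x i * star (x i)) n) * star a).
  by apply: alimMr; apply: alimMl; exact: hinner_cvg.
apply/funext => n; rewrite /series /= mulr_sumr mulr_suml; apply: eq_bigr => i _.
by rewrite /hscale starMr !mulrA.
Qed.

Lemma hinnerZl a x y : HA x -> HA y -> hinner (hscale a x) y = a * hinner x y.
Proof.
move=> hx hy; apply: hinner_eq => //; first exact: HAZ.
rewrite (_ : (fun i => _) = (fun i => a * (x i * star (y i)))).
  by rewrite seriesMl; apply: alimMl; exact: hinner_cvg.
by apply/funext => i; rewrite /hscale mulrA.
Qed.

Lemma hinnerZr a x y : HA x -> HA y -> hinner x (hscale a y) = hinner x y * star a.
Proof.
move=> hx hy; rewrite -hinnerC ?hinnerZl ?starMr ?hinnerC//; exact: HAZ.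
Qed.

Lemma hscaleN1 x : hscale (- 1) x = - x.
Proof. by apply/funext => i; rewrite /hscale mulN1r. Qed.

Lemma hscale0 x : hscale 0 x = 0.
Proof. by apply/funext => i; rewrite /hscale mul0r. Qed.

Lemma hscale1 x : hscale 1 x = x.
Proof. by apply/funext => i; rewrite /hscale mul1r. Qed.

Lemma hscaleA a b x : hscale a (hscale b x) = hscale (a * b) x.
Proof. by apply/funext => i; rewrite /hscale mulrA. Qed.

Lemma hscaleDr a x y : hscale a (x + y) = hscale a x + hscale a y.
Proof. by apply/funext => i; rewrite /hscale mulrDr. Qed.

Lemma hscaleDl a b x : hscale (a + b) x = hscale a x + hscale b x.
Proof. by apply/funext => i; rewrite /hscale mulrDl. Qed.

Lemma hscaler0 a : hscale a 0 = 0 :> (nat -> A).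
Proof. by apply/funext => i; rewrite /hscale mulr0. Qed.

Lemma HA0 : HA (0 : nat -> A).
Proof.
apply: (@HA_alim _ 0); rewrite (_ : series _ = fun=> 0); first exact: alim_const.
by apply/funext => n; rewrite /series /= big1// => i _; rewrite mul0r.
Qed.

Lemma HAN x : HA x -> HA (- x).
Proof. by move=> hx; rewrite -hscaleN1; exact: HAZ. Qed.

Lemma HAB x y : HA x -> HA y -> HA (x - y).
Proof. by move=> hx hy; apply: HAD => //; exact: HAN. Qed.

Lemma hinnerNl x y : HA x -> HA y -> hinner (- x) y = - hinner x y.
Proof. by move=> hx hy; rewrite -hscaleN1 hinnerZl// mulN1r. Qed.

Lemma hinnerNr x y : HA x -> HA y -> hinner x (- y) = - hinner x y.
Proof. by move=> hx hy; rewrite -hscaleN1 hinnerZr// starN star1 mulrN1. Qed.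

Lemma hinnerBl x y z : HA x -> HA y -> HA z -> hinner (x - y) z = hinner x z - hinner y z.
Proof. by move=> hx hy hz; rewrite hinnerDl ?hinnerNl//; exact: HAN. Qed.

Lemma hinnerBr x y z : HA x -> HA y -> HA z -> hinner x (y - z) = hinner x y - hinner x z.
Proof. by move=> hx hy hz; rewrite hinnerDr ?hinnerNr//; exact: HAN. Qed.

Lemma hinner0l x : HA x -> hinner 0 x = 0.
Proof. by move=> hx; rewrite -(hscale0 0) hinnerZl ?mul0r//; exact: HA0. Qed.

Lemma hinner0r x : HA x -> hinner x 0 = 0.
Proof. by move=> hx; rewrite -hinnerC ?hinner0l ?star0//; exact: HA0. Qed.

(** Block sums of <x,x> stay below it: the tails are limits of positive elements. *)
Lemma hinner_sub_sum_pos m n x : HA x ->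
  pos (hinner x x - \sum_(m <= i < n) x i * star (x i)).
Proof.
move=> hx; set w := fun i => x i * star (x i).
have pw i : pos (w i) by exact: pos_sr.
have h := hinner_cvg hx hx.
have [N hN] := h 1 ltr01.
pose v k := series w (maxn (maxn N n) k) - \sum_(m <= i < n) w i.
have vE k : pos (v k).
  rewrite /v /series /=; set M := maxn _ _.
  have nM : (n <= M)%N by rewrite leq_max leq_maxr.
  have [mn|nm] := leqP m n; last first.
    by rewrite [X in _ - X]big_geq ?subr0 ?(ltnW nm)//; exact: pos_sum.
  rewrite (big_cat_nat (leq0n n) nM)//= (big_cat_nat (leq0n m) mn)//= addrAC addrK.
  by apply: posD; exact: pos_sum.
apply: (@pos_lim _ _ v _ (nrm (hinner x x) + 1 + nrm (\sum_(m <= i < n) w i))) => //.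
  move=> k; apply: le_trans (nrmB _ _) _; rewrite lerD2r.
  have := hN (maxn (maxn N n) k); rewrite !leq_max leqnn => /(_ isT) h1.
  have := nrmB (hinner x x) (hinner x x - series w (maxn (maxn N n) k)).
  by rewrite opprB addrC subrK; lra.
apply: alimD; last exact: alim_const.
move=> e /h[N1 hN1]; exists N1 => k Nk; apply: hN1.
by rewrite leq_max Nk orbT.
Qed.

Lemma hinner_pos x : HA x -> pos (hinner x x).
Proof. by move=> hx; have := hinner_sub_sum_pos 0 0 hx; rewrite big_geq// subr0. Qed.

Lemma hnorm_ge0 x : 0 <= hnorm x.
Proof. exact: sqrtr_ge0. Qed.

Lemma hnorm_sqr x : hnorm x ^+ 2 = nrm (hinner x x).
Proof. by rewrite sqr_sqrtr//; exact: nrm_ge0. Qed.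

Lemma hnorm_leP x t : 0 <= t -> (hnorm x <= t) = (nrm (hinner x x) <= t ^+ 2).
Proof. by move=> t0; rewrite -hnorm_sqr ler_pXn2r// nnegrE ?hnorm_ge0. Qed.

Lemma cauchy_schwarz x y : HA x -> HA y -> nrm (hinner x y) <= hnorm x * hnorm y.
Proof.
move=> hx hy; rewrite -(@ler_pXn2r _ 2) ?nnegrE ?nrm_ge0 ?mulr_ge0 ?hnorm_ge0//.
rewrite exprMn !hnorm_sqr; apply: cauchy_schwarz_abstract => [|b]; first exact: hinner_pos.
have hb : HA (hscale b y) by exact: HAZ.
 have hxb := HAB hx hb.
have := hinner_pos hxb.
rewrite hinnerBl// !hinnerBr// !hinnerZl// !hinnerZr// hinnerC//.
rewrite opprB mulrA addrA [X in pos X]addrAC.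
by rewrite [_ - _ - b * _]addrAC.
Qed.

Lemma hnormD x y : HA x -> HA y -> hnorm (x + y) <= hnorm x + hnorm y.
Proof.
move=> hx hy; have hxy := HAD hx hy.
rewrite hnorm_leP ?addr_ge0 ?hnorm_ge0// hinnerDl// !hinnerDr//.
have h1 := nrmD (hinner x x + hinner x y) (hinner y x + hinner y y).
have h2 := nrmD (hinner x x) (hinner x y).
have h3 := nrmD (hinner y x) (hinner y y).
have := cauchy_schwarz hx hy; have := cauchy_schwarz hy hx.
by move: h2 h3; rewrite -!hnorm_sqr; nra.
Qed.

Lemma hnormZ a x : HA x -> hnorm (hscale a x) <= nrm a * hnorm x.
Proof.
move=> hx; rewrite hnorm_leP ?mulr_ge0 ?nrm_ge0 ?hnorm_ge0// hinnerZl ?hinnerZr//; last exact: HAZ.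
rewrite exprMn hnorm_sqr; have h1 := nrmM a (hinner x x * star a).
have := nrmM (hinner x x) (star a); rewrite nrm_star; have := nrm_ge0 a; nra.
Qed.

Lemma hnormN x : HA x -> hnorm (- x) = hnorm x.
Proof. by move=> hx; rewrite /hnorm hinnerNl ?hinnerNr ?opprK//; exact: HAN. Qed.

Lemma hnormB x y : HA x -> HA y -> hnorm (x - y) <= hnorm x + hnorm y.
Proof. by move=> hx hy; rewrite -(hnormN hy) hnormD//; exact: HAN. Qed.

Lemma hnorm_distC x y : HA x -> HA y -> hnorm (x - y) = hnorm (y - x).
Proof. by move=> hx hy; rewrite -hnormN ?opprB//; exact: HAB. Qed.

Lemma hnorm_dist3 x y z : HA x -> HA y -> HA z ->
  hnorm (x - y) <= hnorm (x - z) + hnorm (z - y).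
Proof. by move=> hx hy hz; rewrite -[x - y](subrKA z) hnormD//; exact: HAB. Qed.

Lemma hnorm0 : hnorm (0 : nat -> A) = 0.
Proof. by rewrite /hnorm hinner0l ?normr0 ?sqrtr0//; exact: HA0. Qed.

Lemma hnorm_coord x i : HA x -> nrm (x i) <= hnorm x.
Proof.
move=> hx; rewrite -(@ler_pXn2r _ 2) ?nnegrE ?nrm_ge0 ?hnorm_ge0//.
rewrite hnorm_sqr -nrm_sr; apply: pos_sub_mono; first exact: pos_sr.
by have := hinner_sub_sum_pos i i.+1 hx; rewrite big_nat1.
Qed.

Lemma hnorm0_eq0 x : HA x -> hnorm x = 0 -> x = 0.
Proof.
move=> hx h; apply/funext => i; apply: nrm0_eq0; apply/le_anti.
by rewrite nrm_ge0 -{1}h hnorm_coord.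
Qed.

Lemma hinner_eq0 x : HA x -> hinner x x = 0 -> x = 0.
Proof. by move=> hx h; apply: hnorm0_eq0 => //; rewrite /hnorm h normr0 sqrtr0. Qed.

(** Real scaling written as a scaling by an element of A, so that submodules are
    closed under it and A-linear maps commute with it. *)
Definition hreal t x : nat -> A := hscale (t *:R (1 : A)) x.

Lemma hnorm_real t x : HA x -> hnorm (hreal t x) = `|t| * hnorm x.
Proof.
move=> hx; apply/eqP; rewrite -(@eqrXn2 _ 2) ?mulr_ge0 ?hnorm_ge0//.
apply/eqP; rewrite exprMn !hnorm_sqr hinnerZl// ?hinnerZr//; last exact: HAZ.
rewrite starZR star1 -scaleAl mul1r -scaleAr mulr1 scaleRA nrmZ.
by rewrite normrM expr2.
Qed.

(** ** Truncations and completeness *)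

Definition hcut m n x : nat -> A := fun i => if (m <= i < n)%N then x i else 0.

Lemma hinner_hcut m n x y : alim (series (fun i => hcut m n x i * star (y i)))
  (\sum_(m <= i < n) x i * star (y i)).
Proof.
move=> e e0; exists (maxn m n) => k; rewrite geq_max => /andP[mk nk].
suff -> : series (fun i => hcut m n x i * star (y i)) k =
    \sum_(m <= i < n) x i * star (y i) by rewrite subrr nrm0 ltW.
rewrite /series /= (big_cat_nat (leq0n m) mk)//= big_nat big1 ?add0r; last first.
  by move=> i /andP[_ im]; rewrite /hcut leqNgt im mul0r.
have [nm|mn] := leqP n m.
  rewrite [RHS]big_geq// big_nat big1// => i /andP[mi _].
  by rewrite /hcut ltnNge (leq_trans nm mi) andbF mul0r.
rewrite (big_cat_nat (ltnW mn) nk)//= [X in _ + X]big_nat [X in _ + X]big1 ?addr0; last first.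
  by move=> i /andP[ni _]; rewrite /hcut ltnNge ni andbF mul0r.
by apply: eq_big_nat => i h; rewrite /hcut h.
Qed.

Lemma hcut_mul m n x y i : hcut m n x i * star (hcut m n y i) = hcut m n x i * star (y i).
Proof. by rewrite /hcut; case: ifP => //; rewrite !mul0r. Qed.

Lemma HA_hcut m n x : HA (hcut m n x).
Proof.
apply: (@HA_alim _ (\sum_(m <= i < n) x i * star (x i))).
rewrite (_ : (fun i => _) = (fun i => hcut m n x i * star (x i))); first exact: hinner_hcut.
by apply/funext => i; exact: hcut_mul.
Qed.

Lemma hinner_hcutl m n x y : HA y ->
  hinner (hcut m n x) y = \sum_(m <= i < n) x i * star (y i).
Proof. by move=> hy; apply: hinner_eq => //; [exact: HA_hcut | exact: hinner_hcut]. Qed.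

Lemma hnorm_hcut_sqr m n x :
  hnorm (hcut m n x) ^+ 2 = nrm (\sum_(m <= i < n) x i * star (x i)).
Proof.
rewrite hnorm_sqr hinner_hcutl; last exact: HA_hcut.
congr nrm; apply: eq_big_nat => i h.
by rewrite /hcut h.
Qed.

Lemma hnorm_hcut m n x : HA x -> hnorm (hcut m n x) <= hnorm x.
Proof.
move=> hx; rewrite -(@ler_pXn2r _ 2) ?nnegrE ?hnorm_ge0// hnorm_hcut_sqr hnorm_sqr.
apply: pos_sub_mono; last exact: hinner_sub_sum_pos.
by apply: pos_sum => i; exact: pos_sr.
Qed.

Lemma hcutD m n x y : hcut m n (x + y) = hcut m n x + hcut m n y.
Proof.
by apply/funext => i; rewrite seqDE /hcut seqDE; case: ifP; rewrite ?addr0.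
Qed.

Lemma hcutZ m n a x : hcut m n (hscale a x) = hscale a (hcut m n x).
Proof.
by apply/funext => i; rewrite /hcut /hscale; case: ifP; rewrite ?mulr0.
Qed.

Lemma HAP x : HA x <-> forall e, 0 < e -> exists N, forall m n,
  (N <= m)%N -> (m <= n)%N -> hnorm (hcut m n x) <= e.
Proof.
split => [/summableP h e e0|h].
  have [N hN] := h _ (exprn_gt0 2 e0); exists N => m n Nm mn.
  by rewrite -(@ler_pXn2r _ 2) ?nnegrE ?hnorm_ge0 ?(ltW e0)// hnorm_hcut_sqr; exact: hN.
apply/summableP => e e0; have se : 0 < Num.sqrt e by rewrite sqrtr_gt0.
have [N hN] := h _ se; exists N => m n Nm mn.
by rewrite -hnorm_hcut_sqr -[leRHS]sqr_sqrtr ?(ltW e0)// ler_pXn2r ?nnegrE ?hnorm_ge0 ?sqrtr_ge0 ?hN.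
Qed.

Lemma hnorm_hcut_coord m n x : hnorm (hcut m n x) <= \sum_(m <= i < n) nrm (x i).
Proof.
have [nm|mn] := leqP n m.
  rewrite big_geq// (_ : hcut m n x = 0) ?hnorm0//; apply/funext => i.
  by rewrite /hcut; case: ifP => // /andP[mi /leq_trans/(_ nm)]; rewrite ltnNge mi.
rewrite -(@ler_pXn2r _ 2) ?nnegrE ?hnorm_ge0 ?sumr_ge0//; last by move=> *; exact: nrm_ge0.
rewrite hnorm_hcut_sqr.
suff : 0 <= \sum_(m <= i < n) nrm (x i) /\
    nrm (\sum_(m <= i < n) x i * star (x i)) <= (\sum_(m <= i < n) nrm (x i)) ^+ 2 by case.
elim/big_ind2: _ => [|a r b t [r0 ar] [t0 bt]|i _].
- by rewrite nrm0 expr0n.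
- by split; [rewrite addr_ge0 | apply: le_trans (nrmD _ _) _; nra].
- by rewrite nrm_ge0 nrm_sr.
Qed.

Lemma sum_alim m n (u : nat -> nat -> A) x :
  (forall i, alim (u^~ i) (x i)) -> forall e, 0 < e -> exists N, forall k, (N <= k)%N ->
    \sum_(m <= i < n) nrm (x i - u k i) <= e.
Proof.
move=> h; elim: n => [|n ih] e e0.
  by exists 0%N => k _; rewrite big_geq// ltW.
have e2 : 0 < e / 2 by rewrite divr_gt0.
have [N1 h1] := ih _ e2; have [N2 h2] := h n _ e2.
exists (maxn N1 N2) => k; rewrite geq_max => /andP[/h1 k1 /h2 k2].
have [mn|nm] := leqP m n; last by rewrite big_geq// ltW.
by rewrite big_nat_recr//=; move: k1 k2; lra.
Qed.

Lemma hnorm_le_hcut x t : HA x -> (forall n, hnorm (hcut 0 n x) <= t) -> hnorm x <= t.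
Proof.
move=> hx h; have t0 : 0 <= t := le_trans (hnorm_ge0 _) (h 0%N).
rewrite hnorm_leP// -nrmN -sub0r; apply: alim_le (hinner_cvg hx hx) _ => n.
rewrite sub0r nrmN /series /= -hnorm_hcut_sqr ler_pXn2r ?nnegrE ?hnorm_ge0//.
Qed.

Definition hlim (u : nat -> nat -> A) x : Prop :=
  forall e, 0 < e -> exists N, forall n, (N <= n)%N -> hnorm (x - u n) <= e.

Lemma hcut_hlim x : HA x -> hlim (fun n => hcut 0 n x) x.
Proof.
move=> hx e e0; have [N hN] := (HAP x).1 hx e e0; exists N => n Nn.
have htr : HA (x - hcut 0 n x) by apply: HAB => //; exact: HA_hcut.
apply: hnorm_le_hcut => // k.
rewrite (_ : hcut 0 k _ = hcut n (maxn n k) x); last first.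
  apply/funext => i; rewrite /hcut seqDE seqNE /= leq_max.
  case: (ltnP i n) => /= _; first by rewrite subrr; case: ifP.
  by rewrite oppr0 addr0.
by apply: hN => //; exact: leq_maxl.
Qed.

(** The coordinates converge in A. Bounds on truncations only involve finitely
    many coordinates and pass to the limit uniformly, which puts the limit in the
    module and gives convergence in norm. *)
Lemma hcomplete (u : nat -> nat -> A) : (forall n, HA (u n)) ->
  (forall e, 0 < e -> exists N, forall m n, (N <= m)%N -> (m <= n)%N ->
     hnorm (u n - u m) <= e) -> exists2 x, HA x & hlim u x.
Proof.
move=> hu h.
have /choice[x hx] : forall i, exists l, alim (u^~ i) l.
  move=> i; apply: alim_cauchy => e /h[N hN]; exists N => m n Nm mn.
  by apply: le_trans (hN m n Nm mn); apply: (hnorm_coord i); exact: HAB.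
have key e : 0 < e -> exists N, forall k, (N <= k)%N ->
    forall m n, hnorm (hcut m n (x - u k)) <= e.
  move=> /h[N hN]; exists N => k Nk m n; apply/ler_addgt0Pr => d d0.
  have [L hL] := sum_alim m n hx d0.
  have kl : (k <= maxn L k)%N by rewrite leq_maxr.
  have Ll : (L <= maxn L k)%N by rewrite leq_maxl.
  set l := maxn L k in kl Ll; rewrite -(subrKA (u l)) addrC hcutD.
  apply: le_trans (hnormD _ _) _; try exact: HA_hcut.
  apply: lerD; last exact: le_trans (hnorm_hcut_coord _ _ _) (hL l Ll).
  by apply: le_trans (hN k l Nk kl); apply: hnorm_hcut; exact: HAB.
have HAx : HA x.
  apply/HAP => e e0; have e2 : 0 < e / 2 by rewrite divr_gt0.
  have [N hN] := key _ e2; have [L hL] := (HAP (u N)).1 (hu N) _ e2.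
  exists L => m n Lm mn; rewrite -[x](subrK (u N)) hcutD.
  apply: le_trans (hnormD _ _) _; try exact: HA_hcut.
  by have := hN N (leqnn N) m n; have := hL m n Lm mn; lra.
exists x => // e /key[N hN]; exists N => n Nn.
by apply: hnorm_le_hcut; [exact: HAB | move=> k; exact: hN].
Qed.

End StandardModule.

(** * Closed submodules and closed linear relations *)

Section ClosedRelation.
Context {R : realType} {A : cstarAlgType R}.
Implicit Types (a b c : A) (t r e d : R) (v x y z : nat -> A) (u : nat -> nat -> A).
Implicit Types (M Y : set (nat -> A)).

Lemma submoduleN M x : submodule M -> M x -> M (- x).
Proof. by move=> [_ _ _ MZ] Mx; rewrite -hscaleN1; exact: MZ. Qed.

Lemma submoduleB M x y : submodule M -> M x -> M y -> M (x - y).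
Proof. by move=> sM Mx My; case: (sM) => _ _ MD _; apply: MD => //; exact: submoduleN. Qed.

Lemma closed_submodule_lim M u x : closed_submodule M -> HA x ->
  (forall n, M (u n)) -> hlim u x -> M x.
Proof.
move=> [_ cM] hx Mu ux; apply: cM; split => // e e0.
have [N hN] := ux _ (divr_gt0 e0 (ltr0n R 2)).
exists (u N) => //; apply: le_lt_trans (hN N (leqnn N)) _.
by rewrite gtr_pMr// invf_lt1// ltr1n.
Qed.

Lemma hnorm_small_eq x y : HA x -> HA y -> (forall e, 0 < e -> hnorm (x - y) <= e) -> x = y.
Proof.
move=> hx hy h; apply/eqP; rewrite -subr_eq0; apply/eqP.
apply: hnorm0_eq0; first exact: HAB.
apply/le_anti; rewrite hnorm_ge0 andbT; apply/ler_addgt0Pr => e /h.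
by rewrite add0r.
Qed.

Lemma hrealB t x y : hreal t (x - y) = hreal t x - hreal t y.
Proof. by rewrite /hreal hscaleDr -!hscaleN1 !hscaleA mulN1r mulrN1. Qed.

Lemma hreal1 x : hreal 1 x = x.
Proof. by rewrite /hreal scaleR1 hscale1. Qed.

Lemma hrealA t r x : hreal t (hreal r x) = hreal (t * r) x.
Proof. by rewrite /hreal hscaleA -scaleAl mul1r scaleRA. Qed.

Lemma hrealK t x : t != 0 -> hreal t^-1 (hreal t x) = x.
Proof. by move=> t0; rewrite hrealA mulVf// hreal1. Qed.

Lemma hreal_half x : hreal 2^-1 (x + x) = x.
Proof.
rewrite -[RHS](@hrealK 2) ?pnatr_eq0//; congr hreal.
by rewrite /hreal scaleR2 hscaleDl hscale1.
Qed.

Lemma dependent_choice (T : Type) (P : nat -> T -> Prop) (Q : nat -> T -> T -> Prop) s0 :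
  P 0%N s0 -> (forall n s, P n s -> exists s', P n.+1 s' /\ Q n s s') ->
  exists f : nat -> T, [/\ f 0%N = s0, forall n, P n (f n) & forall n, Q n (f n) (f n.+1)].
Proof.
move=> P0 h.
have /choice[g hg] : forall p : nat * T, exists s', P p.1 p.2 -> P p.1.+1 s' /\ Q p.1 p.2 s'.
  move=> [n s] /=; have [/h[s' hs']|nP] := pselect (P n s); first by exists s'.
  by exists s.
pose f := fix f n := if n is m.+1 then g (m, f m) else s0.
have Pf n : P n (f n) by elim: n => [//|n ih]; case: (hg (n, f n) ih).
by exists f; split => // n; case: (hg (n, f n) (Pf n)).
Qed.

Lemma expr_small (q c e : R) : 0 <= q -> q < 1 -> 0 < e ->
  exists N, forall n, (N <= n)%N -> c * q ^+ n <= e.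
Proof.
move=> q0 q1 e0.
have c1 : 0 < `|c| + 1 by rewrite ltr_wpDl.
have /cvgrPdist_le/(_ (e / (`|c| + 1)) (divr_gt0 e0 c1))[N _ hN] :
    (fun n => q ^+ n) @ \oo --> (0 : R) by apply: cvg_expr; rewrite ger0_norm.
exists N => n /hN /=; rewrite sub0r normrN ger0_norm ?exprn_ge0// ler_pdivlMr// => h.
apply: le_trans h; rewrite mulrC; apply: ler_wpM2l; first exact: exprn_ge0.
by apply: le_trans (ler_norm c) _; rewrite lerDl.
Qed.

Lemma geometric_cvg u (q c : R) : 0 <= q -> q < 1 -> (forall n, HA (u n)) ->
  (forall n, hnorm (u n.+1 - u n) <= c * q ^+ n) ->
  exists x, [/\ HA x, hlim u x & forall n, hnorm (x - u n) <= c * q ^+ n / (1 - q)].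
Proof.
move=> q0 q1 hu h; have q10 : 0 < 1 - q by rewrite subr_gt0.
have c0 : 0 <= c by have := le_trans (hnorm_ge0 _) (h 0%N); rewrite expr0 mulr1.
have step m n : (m <= n)%N -> hnorm (u n - u m) <= (c / (1 - q)) * (q ^+ m - q ^+ n).
  move=> /subnK <-; elim: (n - m)%N => [|k ih]; first by rewrite !subrr mulr0 hnorm0.
  rewrite addSn; apply: le_trans (hnorm_dist3 (hu _) (hu _) (hu (k + m)%N)) _.
  have -> : c / (1 - q) * (q ^+ m - q ^+ (k + m).+1) =
      c * q ^+ (k + m) + c / (1 - q) * (q ^+ m - q ^+ (k + m)).
    by rewrite exprS; field; rewrite gt_eqF.
  exact: lerD.
have bound m n : (m <= n)%N -> hnorm (u n - u m) <= c / (1 - q) * q ^+ m.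
  move=> mn; apply: le_trans (step _ _ mn) _; rewrite ler_wpM2l ?divr_ge0 ?(ltW q10)//.
  by rewrite gerBl exprn_ge0.
have [x hx ux] : exists2 x, HA x & hlim u x.
  apply: hcomplete => // e e0; have [N hN] := expr_small (c / (1 - q)) q0 q1 e0.
  by exists N => m n Nm mn; apply: le_trans (bound _ _ mn) (hN m Nm).
exists x; split => // n; apply/ler_addgt0Pr => e /ux[N hN].
have := hN (maxn N n) (leq_maxl _ _); have := bound n (maxn N n) (leq_maxr _ _).
have := hnorm_dist3 hx (hu n) (hu (maxn N n)).
by rewrite [c * _ / _]mulrAC; lra.
Qed.

(** An open mapping theorem for a closed relation Rel that is linear and covers a
    closed submodule Y. A relation rather than an operator is used because the
    component of a vector in a direct sum is given in that form. *)
Section Relation.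
Variables (Rel : (nat -> A) -> (nat -> A) -> Prop) (Y : set (nat -> A)).
Hypothesis Rel_HA : forall v y, Rel v y -> HA v /\ Y y.
Hypothesis RelD : forall v y v' y', Rel v y -> Rel v' y' -> Rel (v + v') (y + y').
Hypothesis RelZ : forall a v y, Rel v y -> Rel (hscale a v) (hscale a y).
Hypothesis Rel_closed : forall (v y : nat -> nat -> A) v0 y0,
  (forall n, Rel (v n) (y n)) -> HA v0 -> Y y0 -> hlim v v0 -> hlim y y0 -> Rel v0 y0.
Hypothesis Rel_onto : forall y, Y y -> exists v, Rel v y.
Hypothesis cY : closed_submodule Y.

Let sY : submodule Y := cY.1.
Let YHA y : Y y -> HA y. Proof. by case: sY => h _ _ _; exact: h. Qed.
Let Y0 : Y 0. Proof. by case: sY. Qed.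
Let YD x y : Y x -> Y y -> Y (x + y). Proof. by case: sY => _ _ h _; exact: h. Qed.
Let YZ a x : Y x -> Y (hscale a x). Proof. by case: sY => _ _ _; apply. Qed.

Let B (t : R) y := exists2 v, Rel v y & hnorm v <= t.
Let D (t : R) y := forall e, 0 < e -> exists2 y', B t y' & hnorm (y - y') <= e.

(** The closures D t are convex and symmetric, so a translate by z in both
    directions captures z. *)
Let half_diff t x z : Y x -> Y z -> D t (x + z) -> D t (x - z) -> D t z.
Proof.
move=> Yx Yz h1 h2 e e0.
have [y1 [v1 r1 n1] d1] := h1 e e0; have [y2 [v2 r2 n2] d2] := h2 e e0.
have [hv1 Yy1] := Rel_HA r1; have [hv2 Yy2] := Rel_HA r2.
exists (hreal 2^-1 (y1 - y2)).
  exists (hreal 2^-1 (v1 - v2)).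
    by apply: RelZ; apply: RelD => //; rewrite -!hscaleN1; exact: RelZ.
  rewrite hnorm_real; last exact: HAB.
  rewrite ger0_norm ?invr_ge0//; have := hnormB hv1 hv2; lra.
have -> : z - hreal 2^-1 (y1 - y2) = hreal 2^-1 ((x + z - y1) - (x - z - y2)).
  rewrite -[in LHS](hreal_half z) -hrealB; congr hreal.
  have -> : x - z - y2 = (x + z) - (z + z) - y2 by rewrite opprD addrA addrK.
  by rewrite -[_ - (z + z) - y2]addrA -opprD !opprB [RHS]addrC subrKA addrA.
have h1' := YHA (submoduleB sY (YD Yx Yz) Yy1).
have h2' := YHA (submoduleB sY (submoduleB sY Yx Yz) Yy2).
rewrite hnorm_real; last exact: HAB.
by rewrite ger0_norm ?invr_ge0//; have := hnormB h1' h2'; lra.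
Qed.

(** The Baire category argument: were all the closures of the images of balls
    without interior, a nested sequence of points would avoid all of them. *)
Let fat_ball : exists (k : nat) (r : R), 0 < r /\
  forall y, Y y -> hnorm y <= r -> D k%:R y.
Proof.
apply: contrapT => H.
have thin k r : 0 < r -> exists y, [/\ Y y, hnorm y <= r & ~ D k%:R y].
  move=> r0; apply: contrapT => h; apply: H; exists k, r; split => // y Yy yr.
  by apply: contrapT => nD; apply: h; exists y.
have [f [f0 fP fQ]] : exists f : nat -> (nat -> A) * R, [/\ f 0%N = (0, 1),
    forall n, Y (f n).1 /\ 0 < (f n).2 &
    forall n, [/\ hnorm ((f n.+1).1 - (f n).1) <= (f n).2 / 4, (f n.+1).2 <= (f n).2 / 4 &
      forall z, B n%:R z -> (f n.+1).2 < hnorm ((f n.+1).1 - z)]].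
  apply: (@dependent_choice _ (fun=> fun s => Y s.1 /\ 0 < s.2)
    (fun n s s' => [/\ hnorm (s'.1 - s.1) <= s.2 / 4, s'.2 <= s.2 / 4 &
      forall z, B n%:R z -> s'.2 < hnorm (s'.1 - z)])) => [|n [x e] /= [Yx e0]].
    by split => //=.
  have e4 : 0 < e / 4 by rewrite divr_gt0.
  have [y [Yy ye nD]] := thin n _ e4.
  have [x' [Yx' xx' nDx']] : exists x', [/\ Y x', hnorm (x' - x) <= e / 4 & ~ D n%:R x'].
    have [D1|] := pselect (D n%:R (x + y)); last first.
      exists (x + y); split => //; first exact: YD.
      by rewrite addrC addKr.
    exists (x - y); split => //; first exact: submoduleB.
      by rewrite addrC addKr hnormN//; exact: YHA.
    by move=> D2; apply: nD; exact: half_diff D1 D2.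
  have [d d0 hd] : exists2 d, 0 < d & forall z, B n%:R z -> d < hnorm (x' - z).
    apply: contrapT => h; apply: nDx' => d d0; apply: contrapT => h2; apply: h.
    exists d => // z Bz; rewrite ltNge; apply/negP => le; apply: h2.
    by exists z.
  exists (x', Num.min d (e / 4)); rewrite /= lt_min d0 e4; split => //; split => //.
    by rewrite ge_min lexx orbT.
  by move=> z /hd; apply: le_lt_trans; rewrite ge_min lexx.
pose x n := (f n).1; pose e n := (f n).2.
have Yx n : Y (x n) := (fP n).1.
have e0 n : 0 < e n := (fP n).2.
have xS n : hnorm (x n.+1 - x n) <= e n / 4 by case: (fQ n).
have eS n : e n.+1 <= e n / 4 by case: (fQ n).
have eb n : e n <= (4^-1) ^+ n.
  elim: n => [|n ih]; first by rewrite /e f0.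
  by apply: le_trans (eS n) _; rewrite exprS mulrC ler_pM2l ?invr_gt0.
have [x0 [hx0 lx0 _]] : exists x0, [/\ HA x0, hlim x x0 &
    forall n, hnorm (x0 - x n) <= 1 * 4^-1 ^+ n / (1 - 4^-1)].
  apply: geometric_cvg => //; first by rewrite invf_lt1// ltr1n.
    by move=> n; exact: YHA.
  by move=> n; rewrite mul1r; apply: le_trans (xS n) _; have := eb n; have := e0 n; lra.
have Yx0 : Y x0 by apply: closed_submodule_lim lx0.
have near m n : (m <= n)%N -> hnorm (x n - x m) <= e m / 2 - e n / 2.
  move=> /subnK <-; elim: (n - m)%N => [|k ih]; first by rewrite !subrr hnorm0.
  rewrite addSn; apply: le_trans (hnorm_dist3 (YHA (Yx _)) (YHA (Yx _)) (YHA (Yx (k + m)%N))) _.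
  by have := xS (k + m)%N; have := eS (k + m)%N; have := e0 (k + m)%N; lra.
have near0 m : hnorm (x0 - x m) <= e m / 2.
  apply/ler_addgt0Pr => d /lx0[N hN].
  have := hN (maxn N m) (leq_maxl _ _); have := near m (maxn N m) (leq_maxr _ _).
  have := hnorm_dist3 hx0 (YHA (Yx m)) (YHA (Yx (maxn N m))).
  by have := e0 (maxn N m); lra.
have [v rv] := Rel_onto Yx0.
have [k hk] : exists k : nat, hnorm v <= k%:R.
  by exists (Num.bound (hnorm v)); rewrite ltW// archi_boundP// hnorm_ge0.
have [_ _ /(_ x0)] := fQ k.
have Bx : B k%:R x0 by exists v.
move=> /(_ Bx); rewrite -/(x k.+1) -/(e k.+1) hnorm_distC//; last exact: YHA.
by have := near0 k.+1; have := e0 k.+1; lra.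
Qed.

Let Rel00 : Rel 0 0.
Proof. by have [v /(RelZ 0)] := Rel_onto Y0; rewrite !hscale0. Qed.

(** Rescaling fat_ball: every y is approximated arbitrarily well by elements with
    preimages of norm at most C |y|. *)
Let approx : exists2 C : R, 0 <= C & forall y d, Y y -> 0 < d ->
  exists v y', [/\ Rel v y', hnorm v <= C * hnorm y & hnorm (y - y') <= d].
Proof.
have [k [r [r0 hr]]] := fat_ball.
exists (k%:R / r); first by rewrite divr_ge0// ltW.
move=> y d Yy d0; have hy := YHA Yy.
have := hnorm_ge0 y; rewrite le_eqVlt => /orP[/eqP y0|y0].
  exists 0, 0; split => //; first by rewrite hnorm0 -y0 mulr0.
  by rewrite subr0 -y0 ltW.
set t := r / hnorm y; have t0 : 0 < t by rewrite divr_gt0.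
have [|y' [v rv vk] d'] := hr (hreal t y) (YZ _ Yy) _ (d * t) (mulr_gt0 d0 t0).
  by rewrite hnorm_real// gtr0_norm// /t divfK// gt_eqF.
have [hv Yy'] := Rel_HA rv.
exists (hreal t^-1 v), (hreal t^-1 y'); split; first exact: RelZ.
  rewrite hnorm_real// gtr0_norm ?invr_gt0// /t invf_div mulrC.
  by rewrite mulrA mulrAC ler_pM2r// ler_pM2r// invr_gt0.
have -> : y - hreal t^-1 y' = hreal t^-1 (hreal t y - y').
  by rewrite hrealB hrealK// gt_eqF.
rewrite hnorm_real; last by apply: HAB; [exact: HAZ | exact: YHA].
by rewrite gtr0_norm ?invr_gt0// ler_pdivrMl// mulrC.
Qed.

(** Successive approximation: the residuals are halved at each step, so the
    preimages of the corrections have a convergent sum, related to y because Rel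
    is closed. *)
Theorem closed_relation_bounded : exists2 C : R, 0 < C & forall y, Y y ->
  exists2 v, Rel v y & hnorm v <= C * hnorm y.
Proof.
have [C C0 app] := approx.
(* the series of corrections costs a factor 2; adding 1 makes the bound positive *)
exists (2 * C + 1); first by rewrite ltr_wpDl// mulr_ge0.
move=> y Yy; have hy := YHA Yy.
have := hnorm_ge0 y; rewrite le_eqVlt => /orP[/eqP y0|y0].
  exists 0; last by rewrite hnorm0 -y0 mulr0.
  by rewrite (hnorm0_eq0 hy (esym y0)).
set q : R := 2^-1; set rho := hnorm y.
have [f [f0 fP fQ]] : exists f : nat -> (nat -> A) * (nat -> A), [/\ f 0%N = (0, y),
    forall n, [/\ Rel (f n).1 (y - (f n).2), Y (f n).2 & hnorm (f n).2 <= rho * q ^+ n] &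
    forall n, hnorm ((f n.+1).1 - (f n).1) <= C * rho * q ^+ n].
  apply: (@dependent_choice _
    (fun n s => [/\ Rel s.1 (y - s.2), Y s.2 & hnorm s.2 <= rho * q ^+ n])
    (fun n s s' => hnorm (s'.1 - s.1) <= C * rho * q ^+ n)) => [|n [v z] /= [rv Yz zn]].
    by rewrite /= subrr expr0 mulr1.
  have d0 : 0 < rho * q ^+ n.+1 by rewrite mulr_gt0// exprn_gt0// invr_gt0.
  have [w [z' [rw wz zz']]] := app z _ Yz d0.
  have [hw Yz'] := Rel_HA rw.
  exists (v + w, z - z') => /=; split; first split => //.
  - by rewrite opprB [z' - z]addrC addrA; exact: RelD.
  - exact: submoduleB.
  - rewrite addrC addKr; apply: le_trans wz _; rewrite -mulrA ler_wpM2l//.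
have [v0 [hv0 lv0 bv0]] : exists v0, [/\ HA v0, hlim (fun n => (f n).1) v0 &
    forall n, hnorm (v0 - (f n).1) <= C * rho * q ^+ n / (1 - q)].
  apply: geometric_cvg => //; rewrite ?invr_ge0 ?invf_lt1 ?ltr1n//.
  by move=> n; have [/Rel_HA[]] := fP n.
exists v0; last first.
  have := bv0 0%N; rewrite f0 subr0 expr0 mulr1 => /le_trans; apply.
  have -> : 1 - q = q by rewrite /q; lra.
  by rewrite invrK -/rho; have := hnorm_ge0 y; rewrite -/rho; nra.
apply: (Rel_closed (v := fun n => (f n).1) (y := fun n => y - (f n).2)) => //.
  by move=> n; have [] := fP n.
move=> e e0; have q0 : 0 <= q by rewrite invr_ge0.
have q1 : q < 1 by rewrite invf_lt1// ltr1n.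
have [N hN] := expr_small rho q0 q1 e0; exists N => n /hN h.
by rewrite opprB addrC subrK; have [_ _ /le_trans] := fP n; apply.
Qed.

End Relation.
End ClosedRelation.

(** * Closed ranges are orthogonally complemented *)

Section Surjectivity.
Context {R : realType} {A : cstarAlgType R}.
Implicit Types (t r e d : R) (x y z : nat -> A) (V U : (nat -> A) -> (nat -> A)).
Variable N : set (nat -> A).
Hypothesis cN : closed_submodule N.

Let NHA x : N x -> HA x. Proof. by case: cN => -[h _ _ _] _; exact: h. Qed.
Let NB x y : N x -> N y -> N (x - y). Proof. exact: (submoduleB cN.1). Qed.

(** The solution of V x + U x = y is the limit of the iteration
    V x_{n+1} = y - U x_n, a contraction since U is smaller than the lower
    bound of V. *)
Lemma surjective_perturbation V U (K d e : R) :
  (forall x, N x -> N (V x)) -> (forall x, N x -> N (U x)) ->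
  (forall x y, N x -> N y -> V (x - y) = V x - V y) ->
  (forall x y, N x -> N y -> U (x - y) = U x - U y) ->
  (forall x, N x -> hnorm (V x) <= K * hnorm x) ->
  (forall x, N x -> d * hnorm x <= hnorm (V x)) ->
  (forall x, N x -> hnorm (U x) <= e * hnorm x) -> 0 <= e -> e < d ->
  (forall y, N y -> exists2 x, N x & V x = y) ->
  forall y, N y -> exists2 x, N x & V x + U x = y.
Proof.
move=> VN UN VB UB VK Vd Ue e0 ed Vs y Ny.
have d0 : 0 < d := le_lt_trans e0 ed.
have N0 : N 0 by case: cN => -[].
have [f [_ fN fV]] : exists f : nat -> nat -> A, [/\ f 0%N = 0, forall n, N (f n) &
    forall n, V (f n.+1) = y - U (f n)].
  apply: (@dependent_choice _ (fun=> N) (fun _ x x' => V x' = y - U x)) => // _ x Nx.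
  have [x' Nx' Vx'] := Vs _ (NB Ny (UN _ Nx)).
  by exists x'.
set q := e / d.
have q0 : 0 <= q by rewrite divr_ge0// ltW.
have q1 : q < 1 by rewrite ltr_pdivrMr// mul1r.
have step n : hnorm (f n.+1 - f n) <= hnorm (f 1%N - f 0%N) * q ^+ n.
  elim: n => [|n ih]; first by rewrite mulr1.
  have h1 := Vd _ (NB (fN n.+2) (fN n.+1)).
  have h2 : V (f n.+2 - f n.+1) = U (f n - f n.+1).
    by rewrite VB// UB// !fV opprB addrC subrKA.
  have h3 := Ue _ (NB (fN n) (fN n.+1)).
  rewrite exprSr mulrA (_ : _ * q = hnorm (f 1%N - f 0%N) * q ^+ n * e / d); last exact: mulrA.
  rewrite ler_pdivlMr// mulrC.
  apply: le_trans h1 _; rewrite h2; apply: le_trans h3 _.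
  rewrite [leRHS]mulrC hnorm_distC; [|exact: NHA|exact: NHA].
  exact: ler_wpM2l.
have [x [hx lx _]] := geometric_cvg q0 q1 (fun n => NHA (fN n)) step.
have Nx : N x := closed_submodule_lim cN hx fN lx.
exists x => //; apply: hnorm_small_eq; [|exact: NHA|].
  by apply: HAD; apply: NHA; [exact: VN | exact: UN].
move=> r r0; have c0 : 0 < `|K| + e + 1 by rewrite ltr_wpDl// addr_ge0.
have [n hn] := lx _ (divr_gt0 r0 c0).
have -> : V x + U x - y = V (x - f n.+1) + U (x - f n).
  by rewrite VB// UB// fV opprB [U (f n) - y]addrC [V x + (- y + _)]addrA -[RHS]addrA [X in _ = _ + X]addrC subrK addrAC.
have hV := VK _ (NB Nx (fN n.+1)); have hU := Ue _ (NB Nx (fN n)).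
apply: le_trans (hnormD (NHA (VN _ (NB Nx (fN n.+1)))) (NHA (UN _ (NB Nx (fN n))))) _.
have := hn n.+1 (leqnSn n); have := hn n (leqnn n).
have := hnorm_ge0 (x - f n); have := hnorm_ge0 (x - f n.+1).
set p := hnorm (x - f n) in hU *; set s := hnorm (x - f n.+1) in hV *.
rewrite !ler_pdivlMr// => s0 p0 hp hs.
have hV' : hnorm (V (x - f n.+1)) <= `|K| * s.
  by apply: le_trans hV _; rewrite ler_wpM2r// ler_norm.
have K0 := normr_ge0 K; move: hV' hU hp hs.
set k := `|K| in K0 *; move=> hV' hU hp hs.
apply: (@le_trans _ _ (k * s + e * p)); first exact: lerD.
have [sp|ps] := leP s p.
  have := ler_wpM2l K0 sp; move: hp; nra.
by have := ler_wpM2l e0 (ltW ps); move: hs; nra.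
Qed.

(** Continuity method: V + s is surjective for large s, and stays surjective
    while s decreases to 0 in steps shorter than the common lower bound d. *)
Lemma surjective_of_shifts V (K d : R) : 0 <= K -> 0 < d ->
  (forall x, N x -> N (V x)) ->
  (forall x y, N x -> N y -> V (x - y) = V x - V y) ->
  (forall x, N x -> hnorm (V x) <= K * hnorm x) ->
  (forall s x, 0 <= s -> N x -> d * hnorm x <= hnorm (V x + hreal s x)) ->
  forall y, N y -> exists2 x, N x & V x = y.
Proof.
move=> K0 d0 VN VB VK Vd.
have NZ t x : N x -> N (hreal t x) by case: cN => -[_ _ _ h] _; exact: h.
have ND x y : N x -> N y -> N (x + y) by case: cN => -[_ _ h _] _; exact: h.
set S := K + 1; have S0 : 0 < S by rewrite ltr_wpDl.
pose surj s := forall y, N y -> exists2 x, N x & V x + hreal s x = y.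
have surjS : surj S.
  move=> y Ny; suff [x Nx <-] : exists2 x, N x & hreal S x + V x = y.
    by exists x; rewrite // addrC.
  refine (surjective_perturbation (V := hreal S) (U := V) (K := S) (d := S) (e := K)
    _ VN _ VB _ _ VK K0 _ _ Ny).
  - by move=> x; exact: NZ.
  - by move=> x z _ _; exact: hrealB.
  - by move=> x Nx; rewrite hnorm_real ?ger0_norm ?(ltW S0)//; exact: NHA.
  - by move=> x Nx; rewrite hnorm_real ?ger0_norm ?(ltW S0)//; exact: NHA.
  - by rewrite /S ltrDl.
  - move=> z Nz; exists (hreal S^-1 z); first exact: NZ.
    by rewrite hrealA divff ?hreal1// gt_eqF.
(* the bound d is common to all s, so the step length need not shrink *)
have step s t : 0 <= s -> 0 <= t <= d / 2 -> t <= s -> surj s -> surj (s - t).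
  move=> s0 /andP[t0 td] ts hs y Ny.
  suff [x Nx <-] : exists2 x, N x & V x + hreal s x + hreal (- t) x = y.
    by exists x => //; rewrite -addrA; congr (_ + _); rewrite /hreal -hscaleDl -scaleRDl.
  refine (surjective_perturbation (V := fun x => V x + hreal s x) (U := hreal (- t))
    (K := K + s) (d := d) (e := t) _ _ _ _ _ _ _ t0 _ hs Ny).
  - by move=> x Nx; apply: ND; [exact: VN | exact: NZ].
  - by move=> x; exact: NZ.
  - by move=> x z Nx Nz; rewrite VB// hrealB opprD addrACA.
  - by move=> x z _ _; exact: hrealB.
  - move=> x Nx; apply: le_trans (hnormD _ _) _; try by apply: NHA; auto.
    by rewrite mulrDl (hnorm_real s (NHA Nx)) (ger0_norm s0); apply: lerD => //; exact: VK.
  - by move=> x Nx; exact: Vd.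
  - by move=> x Nx; rewrite hnorm_real ?normrN ?ger0_norm//; exact: NHA.
  - by move: td d0; lra.
have [n hn] : exists n : nat, S / (d / 2) < n%:R.
  by exists (Num.bound (S / (d / 2))); rewrite archi_boundP// divr_ge0 ?(ltW S0)// divr_ge0 ?(ltW d0).
have n0 : 0 < n%:R :> R by apply: le_lt_trans hn; rewrite divr_ge0 ?(ltW S0)// divr_ge0 ?(ltW d0).
have tS : 0 <= S / n%:R <= d / 2.
  rewrite divr_ge0 ?(ltW S0)//= ler_pdivrMr// mulrC -ler_pdivrMr ?divr_gt0//.
  exact: ltW.
have main j : (j <= n)%N -> surj (S - j%:R * (S / n%:R)).
  elim: j => [|j ih] jn; first by rewrite mul0r subr0.
  have jn1 : j.+1%:R * (S / n%:R) <= S.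
    by rewrite mulrA ler_pdivrMr// mulrC ler_pM2l// ler_nat.
  have -> : S - j.+1%:R * (S / n%:R) = S - j%:R * (S / n%:R) - S / n%:R.
    by rewrite -[j.+1]addn1 natrD mulrDl mul1r opprD addrA.
  move: jn1; rewrite -[j.+1]addn1 natrD mulrDl mul1r => jn1.
  case/andP: (tS) => t0 _.
  apply: step => //; [by move: jn1 t0; lra | by move: jn1; lra | exact: ih (ltnW jn)].
move=> y Ny; have [x Nx <-] := main n (leqnn n) y Ny.
exists x => //; rewrite mulrC divfK ?gt_eqF// subrr /hreal scale0r.
by rewrite hscale0 addr0.
Qed.

End Surjectivity.

Section ClosedRange.
Context {R : realType} {A : cstarAlgType R}.
Implicit Types (t r e d : R) (x y z : nat -> A) (u : nat -> nat -> A).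
Implicit Types (T : (nat -> A) -> (nat -> A)) (M : set (nat -> A)).

Lemma HA_submodule : submodule (@HA R A).
Proof. by split => //; [exact: HA0 | exact: HAD | move=> a x; exact: HAZ]. Qed.

Lemma Alinear0 M T : submodule M -> Alinear_on M T -> T 0 = 0.
Proof. by move=> [_ M0 _ _] [_ TZ]; rewrite -[in LHS](hscale0 0) TZ// hscale0. Qed.

Lemma AlinearB M T x y : submodule M -> Alinear_on M T -> M x -> M y ->
  T (x - y) = T x - T y.
Proof.
move=> sM [TD TZ] Mx My; rewrite TD//; last exact: submoduleN.
by rewrite -(hscaleN1 y) TZ// hscaleN1.
Qed.

Lemma bounded_onP M T : bounded_on M T ->
  exists2 K : R, 0 < K & forall x, M x -> hnorm (T x) <= K * hnorm x.
Proof.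
move=> [K hK]; exists (`|K| + 1); first by rewrite ltr_wpDl.
move=> x /hK /le_trans; apply; rewrite ler_wpM2r ?hnorm_ge0//.
by apply: le_trans (ler_norm K) _; rewrite lerDl.
Qed.

Lemma hlim_op M T u x : submodule M -> Alinear_on M T -> bounded_on M T ->
  (forall n, M (u n)) -> M x -> hlim u x -> hlim (fun n => T (u n)) (T x).
Proof.
move=> sM lT /bounded_onP[K K0 TK] Mu Mx ux e e0.
have [N hN] := ux _ (divr_gt0 e0 K0); exists N => n /hN.
rewrite ler_pdivlMr// mulrC => h.
by rewrite -(AlinearB sM lT)//; apply: le_trans (TK _ (submoduleB sM Mx (Mu n))) h.
Qed.

Lemma hlim_unique u x y : (forall n, HA (u n)) -> HA x -> HA y -> hlim u x -> hlim u y -> x = y.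
Proof.
move=> hu hx hy ux uy; apply: hnorm_small_eq => // e e0.
have e2 : 0 < e / 2 by rewrite divr_gt0.
have [N1 h1] := ux _ e2; have [N2 h2] := uy _ e2; set n := maxn N1 N2.
have := h1 n (leq_maxl _ _); have := h2 n (leq_maxr _ _).
have := hnorm_dist3 hx hy (hu n); rewrite (hnorm_distC (hu n) hy); lra.
Qed.

(** The graph of S is a closed linear relation that covers the range. *)
Lemma closed_range_preimage (S : (nat -> A) -> (nat -> A)) : Ba S ->
  closed_submodule (S @` (@HA R A)) ->
  exists2 C : R, 0 < C & forall y, (S @` (@HA R A)) y ->
    exists2 v, HA v /\ S v = y & hnorm v <= C * hnorm y.
Proof.
move=> [SHA lS /bounded_onP[K K1 SK] _] cN; have [SD SZ] := lS.
set N := S @` _ in cN *.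
have SB x y : HA x -> HA y -> S (x - y) = S x - S y by exact: AlinearB HA_submodule lS.
have NHA x : N x -> HA x by case: cN => -[h _ _ _] _; exact: h.
apply: (@closed_relation_bounded R A (fun v y => HA v /\ S v = y) N) => //.
- by move=> v y [hv <-]; split => //; exists v.
- by move=> v y v' y' [hv <-] [hv' <-]; split; [exact: HAD | rewrite SD].
- by move=> a v y [hv <-]; split; [exact: HAZ | rewrite SZ].
- move=> v y v0 y0 h hv0 Ny0 lv ly; split => //.
  have hv n : HA (v n) by have [] := h n.
  apply: (@hlim_unique (fun n => S (v n))); [|exact: SHA|exact: NHA| |].
  + by move=> n; exact: SHA.
  + by apply: hlim_op HA_submodule _ _ _ _ lv => //; exists K.
  + by rewrite (_ : (fun n => _) = y)//; apply/funext => n; have [] := h n.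
- by move=> y [v hv <-]; exists v.
Qed.

(** Let C bound preimages under S. On N = S(HA), the positive operator
    V = S S^* satisfies |(V + s) x| |x| >= |<S^* x, S^* x>| >= |x|^2 / C^2 for
    all s >= 0, so V is surjective onto N; if S S^* y = S S^* p with p in N then
    S^*(y - p) = 0, that is y - p is orthogonal to N. *)
Lemma closed_range_complemented (S : (nat -> A) -> (nat -> A)) : Ba S ->
  closed_submodule (S @` (@HA R A)) ->
  forall y, HA y -> exists2 p, (S @` (@HA R A)) p & horth (S @` (@HA R A)) (y - p).
Proof.
move=> hS cN; have [SHA lS /bounded_onP[K K1' SK] [T [THA ST]]] := hS.
have K1 := ltW K1'.
set N := S @` _ in cN *.
have SB x y : HA x -> HA y -> S (x - y) = S x - S y by exact: AlinearB HA_submodule lS.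
have NHA x : N x -> HA x by case: cN => -[h _ _ _] _; exact: h.
have TB x y : HA x -> HA y -> T (x - y) = T x - T y.
  move=> hx hy; have hxy := HAB hx hy.
  apply/eqP; rewrite -subr_eq0; apply/eqP; set w := _ - _.
  have hT := HAB (THA _ hx) (THA _ hy).
  have hw : HA w by apply: HAB => //; exact: THA.
  have [hTx hTy hTxy] := And3 (THA _ hx) (THA _ hy) (THA _ hxy).
  have Sw := SHA _ hw.
  apply: hinner_eq0 => //; rewrite {2}/w.
  by rewrite (hinnerBr hw hTxy hT) (hinnerBr hw hTx hTy) -!ST// hinnerBr// subrr.
have TK y : HA y -> hnorm (T y) <= K * hnorm y.
  move=> hy; have hT := THA _ hy.
  have := hnorm_ge0 (T y); rewrite le_eqVlt => /orP[/eqP <-|T0].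
    by rewrite mulr_ge0// hnorm_ge0.
  rewrite -(ler_pM2r T0) -expr2 hnorm_sqr -ST//.
  apply: le_trans (cauchy_schwarz (SHA _ hT) hy) _.
  by rewrite [K * _ * _]mulrAC ler_wpM2r ?hnorm_ge0// SK.
have [C C0 hC] := closed_range_preimage hS cN.
have low x : N x -> hnorm x <= C * hnorm (T x).
  move=> Nx; have hx := NHA _ Nx; have [v [hv Sv] vC] := hC _ Nx.
  have := hnorm_ge0 x; rewrite le_eqVlt => /orP[/eqP <-|x0].
    by rewrite mulr_ge0 ?(ltW C0)// hnorm_ge0.
  rewrite -(ler_pM2r x0) -expr2 hnorm_sqr -{1}Sv ST//.
  apply: le_trans (cauchy_schwarz hv (THA _ hx)) _.
  by rewrite [C * _ * _]mulrAC ler_wpM2r ?hnorm_ge0.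
have Vsurj : forall y, N y -> exists2 x, N x & S (T x) = y.
  apply: (@surjective_of_shifts _ _ N cN (S \o T) (K * K) (C ^- 2)) => /=.
  - by rewrite mulr_ge0.
  - by rewrite invr_gt0 exprn_gt0.
  - by move=> x /NHA/THA hx; exists (T x).
  - by move=> x y /NHA hx /NHA hy; rewrite TB// SB//; exact: THA.
  - move=> x /NHA hx; apply: le_trans (SK _ (THA _ hx)) _.
    by rewrite -mulrA ler_wpM2l// TK.
  - move=> s x s0 Nx; have hx := NHA _ Nx; have hT := THA _ hx.
    have := hnorm_ge0 x; rewrite le_eqVlt => /orP[/eqP <-|x0].
      by rewrite mulr0 hnorm_ge0.
    have hz : HA (S (T x) + hreal s x) by apply: HAD; [exact: SHA | exact: HAZ].
    have := cauchy_schwarz hz hx.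
    rewrite hinnerDl ?hinnerZl ?ST//; [|exact: SHA|exact: HAZ].
    rewrite -scaleAl mul1r => cs.
    have := pos_nrm_mono (hinner_pos hT) (posZ s0 (hinner_pos hx)).
    rewrite -hnorm_sqr => m; have := le_trans m cs; have := low _ Nx.
    rewrite ler_pdivrMl ?exprn_gt0// => h1 h2.
    rewrite -(ler_pM2r x0) -mulrA; apply: le_trans (ler_wpM2l (exprn_ge0 _ (ltW C0)) h2).
    by rewrite -exprMn -expr2 ler_pXn2r ?nnegrE ?mulr_ge0 ?hnorm_ge0 ?(ltW C0).
move=> y hy; have Ny : N (S (T y)) by exists (T y) => //; exact: THA.
have [p Np Sp] := Vsurj _ Ny; exists p => //.
have hp := NHA _ Np; have hyp := HAB hy hp.
have T0 : T (y - p) = 0.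
  apply: hinner_eq0; first exact: THA.
  rewrite -ST//; last exact: THA.
  by rewrite TB// (SB _ _ (THA _ hy) (THA _ hp)) Sp subrr hinner0l.
split => // _ [x hx <-].
by rewrite -hinnerC ?ST ?T0 ?hinner0r ?star0//; exact: SHA.
Qed.

End ClosedRange.

(** * Adjointable operators and the synthesis operator *)

Section Operators.
Context {R : realType} {A : cstarAlgType R}.
Implicit Types (a b : A) (t r e d : R) (c x y z : nat -> A) (u : nat -> nat -> A).
Implicit Types (F T : (nat -> A) -> (nat -> A)) (M N P X : set (nat -> A)).

Lemma Alinear_sum M T n (c : nat -> A) u : submodule M -> Alinear_on M T ->
  (forall i, M (u i)) -> M (\sum_(i < n) hscale (c i) (u i)) /\
  T (\sum_(i < n) hscale (c i) (u i)) = \sum_(i < n) hscale (c i) (T (u i)).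
Proof.
move=> sM [TD TZ] Mu; have [_ M0 MD MZ] := sM.
elim: n => [|n [ih1 ih2]].
  by rewrite !big_ord0; split => //; apply: Alinear0 sM _.
rewrite !big_ord_recr /=; split; first by apply: MD => //; exact: MZ.
by rewrite TD ?ih2 ?TZ//; exact: MZ.
Qed.

Lemma hinner_ext x y : HA x -> HA y -> (forall z, HA z -> hinner x z = hinner y z) -> x = y.
Proof.
move=> hx hy h; have hxy := HAB hx hy; apply/eqP; rewrite -subr_eq0; apply/eqP.
by apply: hinner_eq0 => //; rewrite hinnerBl// h// subrr.
Qed.

Lemma hinner_hlim u x y : (forall n, HA (u n)) -> HA x -> HA y -> hlim u x ->
  alim (fun n => hinner (u n) y) (hinner x y).
Proof.
move=> hu hx hy ux e e0.
have y0 : 0 < hnorm y + 1 by rewrite ltr_wpDl// hnorm_ge0.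
have [N hN] := ux _ (divr_gt0 e0 y0); exists N => n /hN.
rewrite ler_pdivlMr// => h; rewrite -hinnerBl//.
have hxu := HAB hx (hu n).
apply: le_trans (cauchy_schwarz hxu hy) _; apply: le_trans h.
by rewrite ler_wpM2l ?hnorm_ge0// lerDl.
Qed.

(** ** The standard basis *)

Lemma hbasisE n : hbasis n = hcut n n.+1 (fun=> 1) :> (nat -> A).
Proof.
by apply/funext => i; rewrite /hbasis /hcut ltnS -eqn_leq eq_sym; case: eqP.
Qed.

Lemma HA_hbasis n : HA (hbasis n : nat -> A).
Proof. by rewrite hbasisE; exact: HA_hcut. Qed.

Lemma hinner_hbasis n y : HA y -> hinner (hbasis n) y = star (y n).
Proof. by move=> hy; rewrite hbasisE hinner_hcutl// big_nat1 mul1r. Qed.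

Lemma seq_sumE n (u : 'I_n -> nat -> A) i : (\sum_(j < n) u j) i = \sum_(j < n) u j i.
Proof. exact: (big_morph (fun x : nat -> A => x i)). Qed.

Lemma hcut_basis n x : hcut 0 n x = \sum_(i < n) hscale (x i) (hbasis i).
Proof.
apply/funext => i; rewrite seq_sumE /hcut /= /hscale /hbasis.
case: ltnP => [il|ni].
  rewrite (bigD1 (Ordinal il))//= eqxx mulr1 big1 ?addr0// => j ji.
  rewrite (_ : (i == j) = false) ?mulr0//; apply/negbTE; apply: contra ji => /eqP ij.
  by apply/eqP/val_inj.
rewrite big1// => j _; rewrite (_ : (i == j) = false) ?mulr0//.
by apply/negbTE; rewrite neq_ltn (leq_trans (ltn_ord j) ni) orbT.
Qed.

(** Finite combinations of the basis are dense. *)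
Lemma HA_op_ext F T : Alinear_on (@HA R A) F -> bounded_on (@HA R A) F ->
  Alinear_on (@HA R A) T -> bounded_on (@HA R A) T ->
  (forall x, HA x -> HA (F x)) -> (forall x, HA x -> HA (T x)) ->
  (forall i, F (hbasis i) = T (hbasis i)) -> forall x, HA x -> F x = T x.
Proof.
move=> lF bF lT bT hF hT FT x hx.
have htr n : HA (hcut 0 n x) by exact: HA_hcut.
apply: (@hlim_unique R A (fun n => F (hcut 0 n x)) _ _ _ (hF _ hx) (hT _ hx)).
- by move=> n; exact: hF.
- by apply: hlim_op HA_submodule _ _ _ _ (hcut_hlim hx).
rewrite (_ : (fun n => _) = fun n => T (hcut 0 n x)).
  by apply: hlim_op HA_submodule _ _ _ _ (hcut_hlim hx).
apply/funext => n; rewrite hcut_basis.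
have [_ ->] := Alinear_sum n x HA_submodule lF HA_hbasis.
have [_ ->] := Alinear_sum n x HA_submodule lT HA_hbasis.
by apply: eq_bigr => i _; rewrite FT.
Qed.

(** ** Shifts *)

Definition hshift m x : nat -> A := fun i => if (i < m)%N then 0 else x (i - m)%N.
Definition hdrop m x : nat -> A := fun i => x (m + i)%N.
(** The orthogonal complement of Lsub m; hshift and hdrop identify it with the
    whole module. *)
Definition Rsub m : set (nat -> A) := [set x | HA x /\ forall i, (i < m)%N -> x i = 0].

Lemma hshiftK m x : hdrop m (hshift m x) = x.
Proof. by apply/funext => i; rewrite /hdrop /hshift ltnNge leq_addr /= addKn. Qed.

Lemma hdropK m x : Rsub m x -> hshift m (hdrop m x) = x.
Proof.
move=> [_ x0]; apply/funext => i; rewrite /hdrop /hshift.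
by case: ltnP => [/x0 //|mi]; rewrite subnKC.
Qed.

Lemma alim_shift m (u v : nat -> A) a : (forall k, v (m + k)%N = u k) -> alim u a -> alim v a.
Proof.
move=> uv ua e /ua[N hN]; exists (m + N)%N => n mn.
have mn' : (m <= n)%N := leq_trans (leq_addr _ _) mn.
rewrite -(subnKC mn') uv; apply: hN.
by rewrite leq_subRL.
Qed.

Lemma hshift_cvg m x y : HA x -> HA (hdrop m y) ->
  alim (series (fun i => hshift m x i * star (y i))) (hinner x (hdrop m y)).
Proof.
move=> hx hy; apply: (alim_shift (m := m)) (hinner_cvg hx hy) => k.
rewrite /series /= (big_cat_nat (leq0n m) (leq_addr _ _))//= big_nat big1 ?add0r; last first.
  by move=> i /andP[_ im]; rewrite /hshift im mul0r.
rewrite -{1}[m]add0n big_addn addKn; apply: eq_bigr => i _.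
by rewrite /hshift /hdrop ltnNge leq_addl /= addnK addnC.
Qed.

Lemma HA_shift m x : HA x -> HA (hshift m x).
Proof.
move=> hx; have h : HA (hdrop m (hshift m x)) by rewrite hshiftK.
exact: HA_alim (hshift_cvg hx h).
Qed.

Lemma HA_drop m x : HA x -> HA (hdrop m x).
Proof.
move=> hx; apply/HAP => e e0; have [N hN] := (HAP x).1 hx e e0.
exists N => p n Np pn.
have -> : hnorm (hcut p n (hdrop m x)) = hnorm (hcut (m + p)%N (m + n)%N x).
  apply/eqP; rewrite -(@eqrXn2 _ 2) ?hnorm_ge0// !hnorm_hcut_sqr; apply/eqP; congr nrm.
  rewrite [(m + p)%N]addnC [(m + n)%N]addnC big_addn addnK; apply: eq_bigr => i _.
  by rewrite /hdrop addnC.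
by apply: hN; [exact: leq_trans (leq_addl _ _) | rewrite leq_add2l].
Qed.

Lemma hinner_shift m x y : HA x -> HA y -> hinner (hshift m x) y = hinner x (hdrop m y).
Proof.
move=> hx hy; apply: hinner_eq => //; first exact: HA_shift.
by apply: hshift_cvg => //; exact: HA_drop.
Qed.

Lemma hnorm_shift m x : HA x -> hnorm (hshift m x) = hnorm x.
Proof.
by move=> hx; rewrite /hnorm hinner_shift// ?hshiftK//; exact: HA_shift.
Qed.

Lemma hshiftD m x y : hshift m (x + y) = hshift m x + hshift m y.
Proof. by apply/funext => i; rewrite seqDE /hshift seqDE; case: ifP; rewrite ?addr0. Qed.

Lemma hshiftZ m a x : hshift m (hscale a x) = hscale a (hshift m x).
Proof. by apply/funext => i; rewrite /hshift /hscale; case: ifP; rewrite ?mulr0. Qed.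

Lemma hshift_basis m i : hshift m (hbasis i) = hbasis (m + i) :> (nat -> A).
Proof.
apply/funext => j; rewrite /hshift /hbasis; case: ltnP => [jm|mj].
  by rewrite (_ : (j == (m + i)%N) = false)//; apply/negbTE; rewrite neq_ltn (leq_trans jm) ?leq_addr.
by rewrite -{2}(subnKC mj) eqn_add2l.
Qed.

Lemma Rsub_shift m x : HA x -> Rsub m (hshift m x).
Proof. by move=> hx; split; [exact: HA_shift | move=> i im; rewrite /hshift im]. Qed.

Lemma Ba_shift m F : Ba F -> Ba (F \o hshift m).
Proof.
move=> [FHA [FD FZ] /bounded_onP[K K0 FK] [G [GHA FG]]]; split.
- by move=> x hx /=; apply: FHA; exact: HA_shift.
- by split => [x y hx hy|a x hx] /=; rewrite ?hshiftD ?hshiftZ ?FD ?FZ//; exact: HA_shift.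
- exists K => x hx /=; rewrite -(hnorm_shift m hx); apply: FK; exact: HA_shift.
- exists (hdrop m \o G); split => [y hy|x y hx hy] /=; first by apply: HA_drop; exact: GHA.
  by rewrite FG//; [apply: hinner_shift => //; exact: GHA | exact: HA_shift].
Qed.

(** ** Synthesis *)

Lemma sum_hscale_HA m n u (c : nat -> A) : (forall i, HA (u i)) ->
  HA (\sum_(m <= i < n) hscale (c i) (u i)).
Proof.
move=> hu; elim/big_ind: _; [exact: HA0 | exact: HAD | by move=> i _; exact: HAZ].
Qed.

Lemma hinner_suml m n u (c : nat -> A) y : (forall i, HA (u i)) -> HA y ->
  hinner (\sum_(m <= i < n) hscale (c i) (u i)) y = \sum_(m <= i < n) c i * hinner (u i) y.
Proof.
move=> hu hy.
suff [] : HA (\sum_(m <= i < n) hscale (c i) (u i)) /\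
  hinner (\sum_(m <= i < n) hscale (c i) (u i)) y = \sum_(m <= i < n) c i * hinner (u i) y by [].
elim/big_rec2: _ => [|i v w _ [hw <-]]; first by split; [exact: HA0 | exact: hinner0l].
have h : HA (hscale (c i) (u i)) by exact: HAZ.
by split; [exact: HAD | rewrite hinnerDl// hinnerZl].
Qed.

Lemma is_hsum_hlim u x : is_hsum u x <-> HA x /\ hlim (fun n => \sum_(i < n) u i) x.
Proof.
split => -[hx h]; split => //.
  move=> e e0; move/cvgrPdist_le: h => /(_ e e0)[N _ hN]; exists N => n /hN /=.
  by rewrite sub0r normrN ger0_norm ?hnorm_ge0.
apply/cvgrPdist_le => e /h[N hN]; exists N => // n /hN /=.
by rewrite sub0r normrN ger0_norm ?hnorm_ge0.
Qed.

Section Bessel.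
Variable f : nat -> nat -> A.
Hypothesis hf : bessel f.

Let fHA n : HA (f n) := hf.1 n.

Definition analysis x : nat -> A := fun n => hinner x (f n).

Lemma analysis_bounded : (forall x, HA x -> HA (analysis x)) /\
  exists2 K : R, 0 < K & forall x, HA x -> hnorm (analysis x) <= K * hnorm x.
Proof.
have [_ [K [K0 hK]]] := hf.
have E x : HA x -> (fun n => hinner x (f n) * hinner (f n) x) =
    (fun n => analysis x n * star (analysis x n)).
  by move=> hx; apply/funext => n; rewrite /analysis hinnerC.
split => [x hx|]; first by have [] := hK x hx; rewrite E.
exists (Num.sqrt K); first by rewrite sqrtr_gt0.
move=> x hx; have [c] := hK x hx; rewrite E// in c * => /cstar_leP le.
have hT : HA (analysis x) by [].
rewrite hnorm_leP ?mulr_ge0 ?sqrtr_ge0 ?hnorm_ge0//.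
rewrite exprMn sqr_sqrtr ?(ltW K0)// hnorm_sqr.
have -> : K * nrm (hinner x x) = nrm (K *:R hinner x x) by rewrite nrmZ gtr0_norm.
by apply: pos_sub_mono => //; exact: hinner_pos.
Qed.

(** By duality with the analysis operator: a block w of the synthesis series of c
    has <w, w> = <c', analysis w>, with c' the corresponding block of c, so |w| is at
    most a constant times |c'|. *)
Lemma synthesis_converges (c : nat -> A) : HA c ->
  HA (synthesis f c) /\ hlim (fun n => \sum_(i < n) hscale (c i) (f i)) (synthesis f c).
Proof.
move=> hc; have [aHA [K K0 aK]] := analysis_bounded.
have inn m n y : HA y -> hinner (\sum_(m <= i < n) hscale (c i) (f i)) y =
    hinner (hcut m n c) (analysis y).
  move=> hy; rewrite hinner_suml// hinner_hcutl; last exact: aHA.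
  by apply: eq_bigr => i _; rewrite /analysis hinnerC.
have bd m n : hnorm (\sum_(m <= i < n) hscale (c i) (f i)) <= K * hnorm (hcut m n c).
  set w := \sum_(m <= i < n) _; have hw : HA w by exact: sum_hscale_HA.
  have := hnorm_ge0 w; rewrite le_eqVlt => /orP[/eqP <-|w0].
    by rewrite mulr_ge0 ?(ltW K0)// hnorm_ge0.
  rewrite -(ler_pM2r w0) -expr2 hnorm_sqr inn//.
  have htr : HA (hcut m n c) by exact: HA_hcut.
  apply: le_trans (cauchy_schwarz htr (aHA _ hw)) _.
  by rewrite mulrC mulrAC ler_wpM2r ?hnorm_ge0// aK.
have [x hx lx] : exists2 x, HA x & hlim (fun n => \sum_(i < n) hscale (c i) (f i)) x.
  apply: hcomplete => [n|e e0].
    by rewrite -(big_mkord xpredT (fun i => hscale (c i) (f i))); exact: sum_hscale_HA.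
  have [N hN] := (HAP c).1 hc _ (divr_gt0 e0 K0); exists N => m n Nm mn.
  rewrite -!(big_mkord xpredT (fun i => hscale (c i) (f i))).
  rewrite (big_cat_nat (leq0n m) mn)//=.
  rewrite addrAC subrr add0r.
  by apply: le_trans (bd m n) _; rewrite mulrC -ler_pdivlMr// hN.
have : is_hsum (fun n => hscale (c n) (f n)) (synthesis f c).
  by apply: (@xgetPex _ 0 (is_hsum _)); exists x; apply/is_hsum_hlim.
by move/is_hsum_hlim.
Qed.

Lemma synthesis_adjoint (c : nat -> A) y : HA c -> HA y ->
  hinner (synthesis f c) y = hinner c (analysis y).
Proof.
move=> hc hy; have [aHA _] := analysis_bounded.
have [hs ls] := synthesis_converges hc.
apply: alim_unique (hinner_cvg hc (aHA _ hy)).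
have := hinner_hlim _ hs hy ls.
rewrite (_ : (fun n => hinner _ y) = series (fun i => c i * star (analysis y i))).
  apply => n; rewrite -(big_mkord xpredT (fun i => hscale (c i) (f i))).
  exact: sum_hscale_HA.
apply/funext => n; rewrite -(big_mkord xpredT (fun i => hscale (c i) (f i))) hinner_suml//.
by apply: eq_bigr => i _; rewrite /analysis hinnerC.
Qed.

(** Linearity is read off from the adjoint identity, an element of the module
    being determined by its inner products. *)
Lemma synthesis_Ba : Ba (synthesis f).
Proof.
have [aHA [K K0 aK]] := analysis_bounded.
have sHA c : HA c -> HA (synthesis f c) by move=> /synthesis_converges[].
split => //.
- split => [x y hx hy|a x hx].
    have hxy := HAD hx hy; apply: hinner_ext => [||z hz]; [exact: sHA|by apply: HAD; exact: sHA|].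
    have ha := aHA _ hz; have h1 := sHA _ hx; have h2 := sHA _ hy.
    by rewrite synthesis_adjoint// !hinnerDl// !synthesis_adjoint.
  have hax : HA (hscale a x) by exact: HAZ.
  apply: hinner_ext => [||z hz]; [exact: sHA|by apply: HAZ; exact: sHA|].
  have ha := aHA _ hz; have h1 := sHA _ hx.
  by rewrite synthesis_adjoint// !hinnerZl// synthesis_adjoint.
- exists K => c hc; have hs := sHA _ hc.
  have := hnorm_ge0 (synthesis f c); rewrite le_eqVlt => /orP[/eqP <-|s0].
    by rewrite mulr_ge0 ?(ltW K0)// hnorm_ge0.
  rewrite -(ler_pM2r s0) -expr2 hnorm_sqr synthesis_adjoint//.
  apply: le_trans (cauchy_schwarz hc (aHA _ hs)) _.
  by rewrite mulrC mulrAC ler_wpM2r ?hnorm_ge0// aK.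
- by exists analysis; split => // x y hx hy; exact: synthesis_adjoint.
Qed.

Lemma synthesis_basis n : synthesis f (hbasis n) = f n.
Proof.
have [aHA _] := analysis_bounded.
have hb : HA (hbasis n : nat -> A) by exact: HA_hbasis.
have [hs _] := synthesis_converges hb.
apply: hinner_ext => // z hz; have ha := aHA _ hz.
by rewrite synthesis_adjoint// hinner_hbasis// /analysis hinnerC.
Qed.

End Bessel.
End Operators.

(** * Submodules and decompositions *)

Section Decompositions.
Context {R : realType} {A : cstarAlgType R}.
Implicit Types (a b : A) (t r e d : R) (c x y z : nat -> A) (u : nat -> nat -> A).
Implicit Types (F T J : (nat -> A) -> (nat -> A)) (M N P X : set (nat -> A)).

Lemma HA_closed : closed_submodule (@HA R A).
Proof. by split; [exact: HA_submodule | move=> x []]. Qed.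

Lemma Alinear_on_sub M N T : N `<=` M -> Alinear_on M T -> Alinear_on N T.
Proof. by move=> s [h1 h2]; split => *; [apply: h1; exact: s | apply: h2; exact: s]. Qed.

Lemma bounded_on_sub M N T : N `<=` M -> bounded_on M T -> bounded_on N T.
Proof. by move=> s [K h]; exists K => x /s/h. Qed.

(** The lower bound makes preimages of a Cauchy sequence Cauchy, and bounds the
    inverse. *)
Lemma closed_image M T d : closed_submodule M -> Alinear_on M T -> bounded_on M T ->
  (forall x, M x -> HA (T x)) -> 0 < d ->
  (forall x, M x -> hnorm x <= d * hnorm (T x)) ->
  closed_submodule (T @` M) /\ module_iso M (T @` M) T.
Proof.
move=> cM lT bT hT d0 low; have sM := cM.1; have [MH M0 MD MZ] := sM.
have [TD TZ] := lT.
have TB x y : M x -> M y -> T (x - y) = T x - T y by exact: AlinearB sM lT.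
split; [split|].
- split.
  + by move=> _ [x Mx <-]; exact: hT.
  + by exists 0 => //; exact: Alinear0 sM lT.
  + by move=> _ _ [x Mx <-] [y My <-]; exists (x + y); [exact: MD | exact: TD].
  + by move=> a _ [x Mx <-]; exists (hscale a x); [exact: MZ | exact: TZ].
- move=> y [hy clo].
  have /choice[v hv] n : exists x, M x /\ hnorm (y - T x) <= 1 * 2^-1 ^+ n.
    have p0 : 0 < 2^-1 ^+ n :> R by rewrite exprn_gt0// invr_gt0.
    have [_ [x Mx <-] h] := clo _ p0.
    by exists x; split => //; rewrite mul1r ltW.
  have Mv n : M (v n) := (hv n).1.
  have q1 : 2^-1 < 1 :> R by rewrite invf_lt1// ltr1n.
  have q0 : 0 <= 2^-1 :> R by rewrite invr_ge0.
  have Tvy : hlim (fun n => T (v n)) y.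
    move=> e e0; have [N hN] := expr_small 1 q0 q1 e0.
    by exists N => n /hN; apply: le_trans; exact: (hv n).2.
  have [x hx lx] : exists2 x, HA x & hlim v x.
    apply: hcomplete => [n|e e0]; first exact: MH.
    have [N hN] := Tvy _ (divr_gt0 e0 (mulr_gt0 d0 (ltr0n R 2))).
    exists N => m n Nm mn; apply: le_trans (low _ (submoduleB sM (Mv n) (Mv m))) _.
    rewrite TB//; have := hN m Nm; have := hN n (leq_trans Nm mn).
    have h := hnorm_dist3 (hT _ (Mv n)) (hT _ (Mv m)) hy.
    rewrite (hnorm_distC hy (hT _ (Mv n))) !ler_pdivlMr ?mulr_gt0// => h1 h2.
    by have := ler_wpM2l (ltW d0) h; lra.
  have Mx : M x := closed_submodule_lim cM hx Mv lx.
  exists x => //; apply: (@hlim_unique R A (fun n => T (v n))) => //.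
  + by move=> n; exact: hT.
  + exact: hT.
  + exact: hlim_op sM lT bT Mv Mx lx.
split; [by move=> x Mx; exists x | exact: lT | exact: bT |].
have /choice[T' hT'] : forall y, exists x, (T @` M) y -> M x /\ T x = y.
  move=> y; have [[x Mx <-]|nP] := pselect ((T @` M) y); first by exists x.
  by exists 0.
exists T'; split.
- by move=> y /hT'[].
- by exists d => y /hT'[Mx Tx]; rewrite -{2}Tx low.
- move=> x Mx; have [Mx' Tx'] : M (T' (T x)) /\ T (T' (T x)) = T x by apply: hT'; exists x.
  have MB := submoduleB sM Mx' Mx.
  apply/eqP; rewrite -subr_eq0; apply/eqP/hnorm0_eq0; first exact: MH.
  apply/le_anti; rewrite hnorm_ge0 andbT; apply: le_trans (low _ MB) _.
  by rewrite TB// Tx' subrr hnorm0 mulr0.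
- by move=> y /hT'[].
Qed.

Lemma subisomorphic_bounded_below N X T d : closed_submodule N -> Alinear_on N T ->
  bounded_on N T -> (forall x, N x -> X (T x)) -> X `<=` HA -> 0 < d ->
  (forall x, N x -> hnorm x <= d * hnorm (T x)) -> subisomorphic N X.
Proof.
move=> cN lT bT TX XH d0 low.
have [c i] := closed_image cN lT bT (fun x Nx => XH _ (TX x Nx)) d0 low.
exists (T @` N); split => //; last by exists T.
by move=> _ [x Nx <-]; exact: TX.
Qed.

Lemma module_iso_bounded_below M X T : submodule M -> module_iso M X T ->
  exists2 d : R, 0 < d & forall x, M x -> hnorm x <= d * hnorm (T x).
Proof.
move=> sM [MX _ _ [T' [_ /bounded_onP[d d0 hd] T'T _]]].
by exists d => // x Mx; rewrite -{1}(T'T x Mx) hd//; exact: MX.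
Qed.

Lemma horth_closed X : X `<=` HA -> closed_submodule (horth X).
Proof.
move=> XH; split; first split.
- by move=> x [].
- by split => [|y Xy]; [exact: HA0 | rewrite hinner0l//; exact: XH].
- move=> x y [hx ox] [hy oy]; split => [|z Xz]; first exact: HAD.
  by rewrite hinnerDl ?ox ?oy ?addr0//; exact: XH.
- move=> a x [hx ox]; split => [|z Xz]; first exact: HAZ.
  by rewrite hinnerZl ?ox ?mulr0//; exact: XH.
move=> x [hx clo]; split => // z Xz; have hz := XH _ Xz.
apply: nrm0_eq0; apply/le_anti; rewrite nrm_ge0 andbT; apply/ler_addgt0Pr => e e0.
have z0 : 0 < hnorm z + 1 by rewrite ltr_wpDl// hnorm_ge0.
have [y [hy oy] xy] := clo _ (divr_gt0 e0 z0).
have hxy := HAB hx hy.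
rewrite add0r -[hinner x z]subr0 -(oy z Xz) -hinnerBl//.
apply: le_trans (cauchy_schwarz hxy hz) _.
rewrite ltr_pdivlMr// in xy; apply: le_trans (ltW xy).
by rewrite ler_wpM2l ?hnorm_ge0// lerDl.
Qed.

Lemma coord_closed (I : pred nat) :
  closed_submodule [set x : nat -> A | HA x /\ forall i, I i -> x i = 0].
Proof.
split; first split.
- by move=> x [].
- by split => //; exact: HA0.
- move=> x y [hx x0] [hy y0]; split => [|i Ii]; first exact: HAD.
  by rewrite seqDE x0// y0// addr0.
- move=> a x [hx x0]; split => [|i Ii]; first exact: HAZ.
  by rewrite /hscale x0// mulr0.
move=> x [hx clo]; split => // i Ii; apply: nrm0_eq0; apply/le_anti.
rewrite nrm_ge0 andbT; apply/ler_addgt0Pr => e /clo[y [hy y0] xy].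
rewrite add0r; have hxy := HAB hx hy.
have := hnorm_coord i hxy; rewrite seqDE seqNE y0// subr0 => /le_trans; apply.
exact: ltW.
Qed.

Lemma Rsub_closed m : closed_submodule (@Rsub R A m).
Proof. exact: (@coord_closed (fun i => (i < m)%N)). Qed.

Lemma Lsub_closed m : closed_submodule (@Lsub R A m).
Proof. exact: (@coord_closed (fun i => (m <= i)%N)). Qed.

Lemma Lsub_hcut m x : Lsub m (hcut 0 m x).
Proof.
by split => [|i mi]; [exact: HA_hcut | rewrite /hcut /= ltnNge mi].
Qed.

Lemma Rsub_hcut m x : HA x -> Rsub m (x - hcut 0 m x).
Proof.
move=> hx; split => [|i im]; first by apply: HAB => //; exact: HA_hcut.
by rewrite seqDE seqNE /hcut /= im subrr.
Qed.

Lemma Lsub_Rsub_orth m x y : Lsub m x -> Rsub m y -> hinner x y = 0.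
Proof.
move=> [hx x0] [hy y0]; apply: hinner_eq => //.
rewrite (_ : series _ = fun=> 0); first exact: alim_const.
apply/funext => n; rewrite /series /= big1// => i _.
by case: (ltnP i m) => [/y0 ->|/x0 ->]; rewrite ?star0 ?mulr0 ?mul0r.
Qed.

Lemma hnorm_orth_le x y : HA x -> HA y -> hinner y x = 0 -> hnorm x <= hnorm (y + x).
Proof.
move=> hx hy xy; have hyx := HAD hy hx.
have := hnorm_ge0 x; rewrite le_eqVlt => /orP[/eqP <-|x0]; first exact: hnorm_ge0.
rewrite -(ler_pM2r x0) -expr2 hnorm_sqr.
apply: le_trans (cauchy_schwarz hyx hx).
by rewrite hinnerDl// xy add0r.
Qed.

Lemma orthogonal_projection N : closed_submodule N ->
  (forall y, HA y -> exists2 p, N p & horth N (y - p)) ->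
  exists P : (nat -> A) -> (nat -> A), [/\ forall y, HA y -> N (P y),
    forall y, HA y -> horth N (y - P y), Alinear_on HA P,
    forall y, HA y -> hnorm (P y) <= hnorm y &
    forall y, HA y -> hnorm (y - P y) <= hnorm y].
Proof.
move=> cN h; have sN := cN.1; have [NH _ ND NZ] := sN.
have [sO _] := horth_closed NH; have [_ _ OD OZ] := sO.
have /choice[P hP] : forall y, exists p, HA y -> N p /\ horth N (y - p).
  move=> y; have [/h[p Np op]|nH] := pselect (HA y); first by exists p.
  by exists 0.
have PN y : HA y -> N (P y) by move=> /hP[].
have PO y : HA y -> horth N (y - P y) by move=> /hP[].
have uniq y p q : N p -> N q -> horth N (y - p) -> horth N (y - q) -> p = q.
  move=> Np Nq op oq; have Npq := submoduleB sN Np Nq.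
  have [hpq opq] : horth N (p - q).
    by rewrite -[p - q](subrKA y) addrC -opprB; exact: (submoduleB sO oq op).
  by apply/eqP; rewrite -subr_eq0; apply/eqP; apply: hinner_eq0 (opq _ Npq).
exists P; split => //.
- split => [x y hx hy|a x hx].
    have hxy := HAD hx hy; apply: (uniq (x + y)) => //; [exact: PN|by apply: ND; exact: PN|exact: PO|].
    by rewrite opprD addrACA; apply: OD; exact: PO.
  have hax : HA (hscale a x) by exact: HAZ.
  apply: (uniq (hscale a x)) => //; [exact: PN|by apply: NZ; exact: PN|exact: PO|].
  have -> : hscale a x - hscale a (P x) = hscale a (x - P x).
    by rewrite hscaleDr -!hscaleN1 !hscaleA mulN1r mulrN1.
  by apply: OZ; exact: PO.
- move=> y hy; have [hyp oyp] := PO _ hy; have Np := PN _ hy; have hp := NH _ Np.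
  by have := hnorm_orth_le hp hyp (oyp _ Np); rewrite subrK.
- move=> y hy; have [hyp oyp] := PO _ hy; have Np := PN _ hy; have hp := NH _ Np.
  have := hnorm_orth_le hyp hp; rewrite [P y + _]addrC subrK; apply.
  by rewrite -hinnerC// oyp// star0.
Qed.

Lemma hinner_horth0 N x : N x -> horth N x -> x = 0.
Proof. by move=> Nx [hx ox]; apply: hinner_eq0 => //; exact: ox. Qed.

Lemma direct_sum_unique M N x y : direct_sum HA M N -> M x -> N y -> x + y = 0 -> x = 0.
Proof.
move=> [cM cN MN _] Mx Ny /eqP; rewrite addr_eq0 => /eqP xy.
have : (M `&` N) x by split => //; rewrite xy; exact: submoduleN cN.1 Ny.
by rewrite MN.
Qed.

(** The two closed summands play the part of the closed linear relation
    relating v to y when v is the component of y in M. *)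
Lemma direct_sum_bounded M N : direct_sum HA M N ->
  exists2 C : R, 0 < C & forall x y, M x -> N y -> hnorm x <= C * hnorm (x + y).
Proof.
move=> dMN; have [cM cN MN sum] := dMN.
have [MH _ MD MZ] := cM.1; have [NH _ ND NZ] := cN.1.
have [C C0 hC] : exists2 C : R, 0 < C & forall y, HA y ->
    exists2 v, [/\ M v, HA y & N (y - v)] & hnorm v <= C * hnorm y.
  apply: (@closed_relation_bounded R A (fun v y => [/\ M v, HA y & N (y - v)]) HA).
  - by move=> v y [Mv hy _]; split => //; exact: MH.
  - move=> v y v' y' [Mv hy Nv] [Mv' hy' Nv']; split; [exact: MD | exact: HAD |].
    by rewrite opprD addrACA; exact: ND.
  - move=> a v y [Mv hy Nv]; split; [exact: MZ | exact: HAZ |].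
    by rewrite -(hscaleN1 (hscale _ _)) hscaleA mulN1r -mulrN1 -hscaleA hscaleN1 -hscaleDr; exact: NZ.
  - move=> v y v0 y0 h hv0 hy0 lv ly.
    have hv n : M (v n) by have [] := h n.
    have hy n : HA (y n) by have [] := h n.
    have hN n : N (y n - v n) by have [] := h n.
    split => //; first exact: closed_submodule_lim lv.
    apply: (closed_submodule_lim (u := fun n => y n - v n)) => //; first exact: HAB.
    move=> e e0; have e2 : 0 < e / 2 by rewrite divr_gt0.
    have [N1 h1] := lv _ e2; have [N2 h2] := ly _ e2; exists (maxn N1 N2) => n.
    rewrite geq_max => /andP[/h1 n1 /h2 n2].
    have -> : y0 - v0 - (y n - v n) = (y0 - y n) - (v0 - v n).
      by rewrite !opprB addrACA [_ + (v n - v0)]addrC [RHS]addrACA [v n + _]addrC.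
    have := hnormB (HAB hy0 (hy n)) (HAB hv0 (MH _ (hv n))); lra.
  - move=> y hy; have [x Mx [z Nz xz]] : [set x + y | x in M & y in N] y by rewrite sum.
    by exists x; split => //; rewrite -xz addrC addKr.
  - exact: HA_closed.
exists C => // x y Mx Ny; have hxy := HAD (MH _ Mx) (NH _ Ny).
have [v [Mv _ Nv] vC] := hC _ hxy.
suff xv : x = v by rewrite {1}xv.
apply/eqP; rewrite -subr_eq0; apply/eqP.
apply: (direct_sum_unique dMN (submoduleB cM.1 Mx Mv) (submoduleB cN.1 Ny Nv)).
have -> : x + y - v = y + (x - v) by rewrite addrA [y + x]addrC.
by rewrite opprD [y + _]addrA subrr sub0r subrr.
Qed.

End Decompositions.

(** * Pseudo-Riesz-Weyl sequences have upper semi-Weyl synthesis operators *)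

Section Forward.
Context {R : realType} {A : cstarAlgType R}.
Implicit Types (a b : A) (t r e d : R) (c x y z : nat -> A) (u f : nat -> nat -> A).
Implicit Types (F T J : (nat -> A) -> (nat -> A)) (M N P X : set (nat -> A)).

(** F applied to the shifted basis gives the tail, and finite sequences are dense,
    so the closed range of F on shifted sequences is the closed span. *)
Lemma hclosure_span f m (S := synthesis f \o hshift m) : bessel f ->
  closed_submodule (S @` (@HA R A)) -> hclosure (hspan (tail m f)) = S @` (@HA R A).
Proof.
move=> hf cS; have [SHA lS bS _] := Ba_shift m (synthesis_Ba hf).
have Sb i : S (hbasis i) = f (m + i)%N by rewrite /S /= hshift_basis synthesis_basis.
apply/seteqP; split => x.
  move=> [hx clo]; apply: cS.2; split => // e /clo[y [n [c ->]] xy].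
  exists (\sum_(i < n) hscale (c i) (tail m f i)) => //.
  have [h1 h2] := Alinear_sum n c HA_submodule lS HA_hbasis.
  by exists (\sum_(i < n) hscale (c i) (hbasis i)) => //; apply: etrans h2 _; apply: eq_bigr => i _; congr hscale; exact: Sb.
move=> [c hc <-]; split => [|e e0]; first exact: SHA.
have htr n : HA (hcut 0 n c) by exact: HA_hcut.
have [N hN] := hlim_op HA_submodule lS bS htr hc (hcut_hlim hc) (divr_gt0 e0 (ltr0n R 2)).
exists (S (hcut 0 N c)).
  exists N, c; rewrite hcut_basis.
  have [_ h] := Alinear_sum N c HA_submodule lS HA_hbasis; apply: etrans h _.
  by apply: eq_bigr => i _; congr hscale; exact: Sb.
by apply: le_lt_trans (hN N (leqnn N)) _; rewrite gtr_pMr// invf_lt1// ltr1n.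
Qed.

(** With X the closed span of the tail, H = X + X^perp. The choice
    M1 = L_m^perp, N1 = F^{-1}(X^perp) works: F maps M1 isomorphically onto X,
    and since F x is orthogonal to X for x in N1, the coordinates from m on of x
    are controlled by, and recovered from, the first m ones; so N1 is generated
    by m elements and embeds into L_m, hence into X^perp. *)
Lemma synthesis_upper_semi_weyl f : pseudo_riesz_weyl f -> upper_semi_weyl (synthesis f).
Proof.
move=> [hf [m]] /=; set X := hclosure _; move=> [m0 [T [iT _ Tb]] sub].
set F := synthesis f; have BF : Ba F := synthesis_Ba hf.
have [FHA lF bF _] := BF; have [FD FZ] := lF.
have FB x y : HA x -> HA y -> F (x - y) = F x - F y by exact: AlinearB HA_submodule lF.
set S := F \o hshift m; have BS : Ba S := Ba_shift m BF.
have [SHA lS bS _] := BS.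
have XH : X `<=` HA by move=> x [].
have [TX lT bT [T' [T'HA bT' T'T TT']]] := iT.
have TS x : HA x -> T x = S x.
  apply: HA_op_ext => //; first by move=> y hy; exact/XH/TX.
  by move=> i; rewrite Tb /S /= hshift_basis /F synthesis_basis.
have [d d0 low] := module_iso_bounded_below HA_submodule iT.
have lowS x : HA x -> hnorm x <= d * hnorm (S x) by move=> hx; rewrite -TS//; exact: low.
have [cS _] := closed_image HA_closed lS bS SHA d0 lowS.
have XS : X = S @` (@HA R A) by exact: hclosure_span.
have cX : closed_submodule X by rewrite XS.
have proj y : HA y -> exists2 z, HA z & horth X (y - S z).
  move=> hy; have [_ [z hz <-] o] := closed_range_complemented BS cS hy.
  by exists z; rewrite // XS.
have cO : closed_submodule (horth X) := horth_closed XH.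
have [_ _ OD OZ] := cO.1; have [_ _ RD _] := (@Rsub_closed R A m).1.
pose N1 := [set x | HA x /\ horth X (F x)].
have FX x : Rsub m x -> X (F x).
  move=> rx; rewrite XS; exists (hdrop m x); first by apply: HA_drop; exact: rx.1.
  by rewrite /S /= hdropK.
have RN0 x : Rsub m x -> N1 x -> x = 0.
  move=> rx [hx ox]; have F0 := hinner_horth0 (FX _ rx) ox.
  apply: hnorm0_eq0 => //; apply/le_anti; rewrite hnorm_ge0 andbT.
  rewrite -(hdropK rx) hnorm_shift; last exact: HA_drop.
  apply: le_trans (lowS (hdrop m x) (HA_drop hx)) _.
  by rewrite /S /= hdropK// F0 hnorm0 mulr0.
have cN1 : closed_submodule N1.
  split; first split.
  - by move=> x [].
  - by split; [exact: HA0 | rewrite (Alinear0 HA_submodule lF); case: cO => -[]].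
  - by move=> x y [hx ox] [hy oy]; split; [exact: HAD | rewrite FD//; exact: OD].
  - by move=> a x [hx ox]; split; [exact: HAZ | rewrite FZ//; exact: OZ].
  move=> x [hx clo]; split => //; apply: cO.2; split => [|e e0]; first exact: FHA.
  have [K K0 FK] := bounded_onP bF.
  have [y [hy oy] xy] := clo _ (divr_gt0 e0 K0); exists (F y) => //.
  rewrite -FB//; apply: le_lt_trans (FK _ (HAB hx hy)) _.
  by rewrite mulrC -ltr_pdivlMr.
split => //; exists (Rsub m), N1, X, (horth X); split; last split.
- split => //; first exact: Rsub_closed.
    apply/seteqP; split => [x [rx nx]|x ->]; first exact: RN0.
    by split; [case: (@Rsub_closed R A m) => -[] | case: cN1 => -[]].
  apply/seteqP; split => [_ [x [hx _] [y [hy _] <-]]|x hx]; first exact: HAD.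
  have [z hz oz] := proj _ (FHA _ hx).
  have rz : Rsub m (hshift m z) by exact: Rsub_shift.
  exists (hshift m z) => //; exists (x - hshift m z); last by rewrite addrC subrK.
  by split; [apply: HAB => //; exact: rz.1 | rewrite FB//; exact: rz.1].
- split => //.
    apply/seteqP; split => [x [Xx ox]|x ->]; first exact: hinner_horth0 Xx ox.
    by split; [case: cX => -[] | case: cO => -[]].
  apply/seteqP; split => [_ [x Xx [y [hy _] <-]]|x hx]; first by apply: HAD => //; exact: XH.
  have [z hz oz] := proj _ hx.
  exists (S z); first by rewrite XS; exists z.
  by exists (x - S z); rewrite // addrC subrK.
- exact: FX.
- by move=> x [].
- have RH : Rsub m `<=` (@HA R A) by move=> x [].
  split; [exact: FX | exact: Alinear_on_sub lF | exact: bounded_on_sub bF |].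
  exists (hshift m \o T'); split => /=.
  + by move=> y Xy; apply: Rsub_shift; exact: T'HA.
  + have [K hK] := bT'; exists K => y Xy /=; rewrite hnorm_shift; [exact: hK | exact: T'HA].
  + move=> x rx; have hd : HA (hdrop m x) by apply: HA_drop; exact: rx.1.
    have -> : F x = T (hdrop m x) by rewrite (TS _ hd) /S /= hdropK.
    by rewrite T'T// hdropK.
  + by move=> y Xy; rewrite -[RHS]TT'// TS//; exact: T'HA.
- have /choice[z hz] j : exists z, HA z /\ horth X (F (hbasis j) - S z).
    have [z hz oz] := proj _ (FHA _ (@HA_hbasis R A j)).
    by exists z.
  pose g j := hbasis j - hshift m (z j).
  have gN j : N1 (g j).
    have hs : HA (hshift m (z j)) by apply: HA_shift; exact: (hz j).1.
    have hb : HA (hbasis j : nat -> A) by exact: HA_hbasis.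
    by split; [exact: HAB | rewrite /g FB//; exact: (hz j).2].
  exists m, (fun j : 'I_m => g j); split => [j|x nx]; first exact: gN.
  exists (fun j : 'I_m => x j).
  have N1H : submodule N1 := cN1.1.
  have [sN _] := @Alinear_sum _ _ N1 id m x g N1H (conj (fun _ _ _ _ => erefl) (fun _ _ _ => erefl)) gN.
  apply/eqP; rewrite -subr_eq0; apply/eqP; apply: RN0; last exact: submoduleB.
  have -> : \sum_(i < m) hscale (x i) (g i) =
      hcut 0 m x - \sum_(i < m) hscale (x i) (hshift m (z i)).
    rewrite hcut_basis -sumrB; apply: eq_bigr => i _.
    by rewrite /g hscaleDr -!hscaleN1 !hscaleA mulN1r mulrN1.
  rewrite opprB addrA addrAC; apply: RD; first by apply: Rsub_hcut; exact: nx.1.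
  have [|h _] := @Alinear_sum _ _ (Rsub m) id m x (fun i => hshift m (z i)) (@Rsub_closed R A m).1
    (conj (fun _ _ _ _ => erefl) (fun _ _ _ => erefl)); last exact: h.
  by move=> i; apply: Rsub_shift; exact: (hz i).1.
- have [P [cP PO [J iJ]]] := sub.
  have [JP lJ bJ _] := iJ; have [JD JZ] := lJ.
  have [dJ dJ0 lowJ] := module_iso_bounded_below (@Lsub_closed R A m).1 iJ.
  have [K K0 FK] := bounded_onP bF; have [KJ KJ0 JK] := bounded_onP bJ.
  have tN x : N1 x -> hnorm x <= (1 + d * K) * hnorm (hcut 0 m x).
    move=> [hx ox]; set b := hcut 0 m x; set a := x - b.
    have hb : HA b by exact: HA_hcut.
    have ra : Rsub m a by exact: Rsub_hcut.
    have ha : HA a := ra.1.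
    have Fa : hnorm (F a) <= hnorm (F b).
      have hFa := FHA _ ha; have hFx := FHA _ hx.
      have oxa : hinner (F x) (F a) = 0 by apply: ox.2; exact: FX.
      have e : hinner (- F x) (F a) = 0 by rewrite (hinnerNl hFx hFa) oxa oppr0.
      have := hnorm_orth_le hFa (HAN hFx) e.
      have -> : - F x + F a = - F b by rewrite /a (FB _ _ hx hb) addrA addNr add0r.
      by rewrite (hnormN (FHA _ hb)).
    have Fa' : hnorm a <= d * hnorm (F a).
      have hd : HA (hdrop m a) by exact: HA_drop.
      by have := lowS _ hd; rewrite /S /= hdropK// -(hnorm_shift m hd) hdropK.
    have := hnormD ha hb; rewrite subrK => h; apply: le_trans h _.
    have Fb := FK _ hb; have := le_trans Fa Fb; rewrite -(ler_pM2l d0) => h.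
    by rewrite mulrDl mul1r addrC lerD2l; apply: le_trans Fa' _; rewrite -mulrA.
  have L x : HA x -> Lsub m (hcut 0 m x) by move=> _; exact: Lsub_hcut.
  apply: (@subisomorphic_bounded_below R A N1 (horth X) (J \o hcut 0 m) ((1 + d * K) * dJ)); first exact: cN1.
  + split => [x y [hx _] [hy _]|a x [hx _]] /=.
      by rewrite hcutD JD//; exact: L.
    by rewrite hcutZ JZ//; exact: L.
  + exists KJ => x [hx _] /=; apply: le_trans (JK _ (L _ hx)) _.
    by rewrite ler_wpM2l ?(ltW KJ0)// hnorm_hcut.
  + by move=> x [hx _]; apply: PO; apply: JP; exact: L.
  + by move=> x [].
  + by apply: mulr_gt0 => //; apply: ltr_wpDr => //; exact: mulr_ge0 (ltW d0) (ltW K0).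
  + move=> x nx; apply: le_trans (tN _ nx) _; rewrite -mulrA ler_wpM2l ?addr_ge0 ?mulr_ge0 ?(ltW d0) ?(ltW K0)//.
    by apply: lowJ; apply: L; exact: nx.1.
Qed.

End Forward.

(** * Upper semi-Weyl synthesis operators come from pseudo-Riesz-Weyl sequences *)

Section Converse.
Context {R : realType} {A : cstarAlgType R}.
Implicit Types (a b : A) (t r e d : R) (c x y z : nat -> A) (u f g : nat -> nat -> A).
Implicit Types (F T J : (nat -> A) -> (nat -> A)) (M N P X : set (nat -> A)).

Definition finite_synthesis n g c : nat -> A := \sum_(j < n) hscale (c j) (g j).

Lemma finite_synthesis_adjoint n g c y : (forall j, HA (g j)) -> HA c -> HA y ->
  hinner (finite_synthesis n g c) y = hinner c (hcut 0 n (fun j => hinner y (g j))).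
Proof.
move=> hg hc hy; rewrite /finite_synthesis.
rewrite -(big_mkord xpredT (fun j => hscale (c j) (g j))) (hinner_suml _ _ _ hg hy).
rewrite -(hinnerC (HA_hcut (m := 0) (n := n) (x := fun j => hinner y (g j))) hc).
rewrite (hinner_hcutl _ _ _ hc) star_sum; apply: eq_bigr => j _.
by rewrite starMr starK (hinnerC hy (hg j)).
Qed.

Lemma finite_synthesis_Ba n g : (forall j, HA (g j)) -> Ba (finite_synthesis n g).
Proof.
move=> hg.
have GHA c : HA (finite_synthesis n g c).
  rewrite /finite_synthesis -(big_mkord xpredT (fun j => hscale (c j) (g j))).
  exact: sum_hscale_HA.
split; first by move=> c _; exact: GHA.
- split => [x y _ _|a x _]; rewrite /finite_synthesis.
    by rewrite -big_split /=; apply: eq_bigr => j _; rewrite seqDE hscaleDl.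
  rewrite (big_morph (hscale a) (hscaleDr a) (hscaler0 a)).
  by apply: eq_bigr => j _; rewrite hscaleA.
- exists (\sum_(j < n) hnorm (g j)) => c hc.
  rewrite /finite_synthesis; suff [] : HA (\sum_(j < n) hscale (c j) (g j)) /\
    hnorm (\sum_(j < n) hscale (c j) (g j)) <= (\sum_(j < n) hnorm (g j)) * hnorm c by [].
  elim/big_rec2: _ => [|j v t _ [hv IH]].
    by split; [exact: HA0 | rewrite hnorm0 mul0r].
  have hs : HA (hscale (c j) (g j)) by exact: HAZ.
  split; first exact: HAD.
  apply: le_trans (hnormD hs hv) _; rewrite mulrDl; apply: lerD => //.
  apply: le_trans (hnormZ _ (hg j)) _; rewrite mulrC.
  by apply: ler_wpM2l; [exact: hnorm_ge0 | exact: hnorm_coord].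
- exists (fun y => hcut 0 n (fun j => hinner y (g j))); split => [y _|x y hx hy].
    exact: HA_hcut.
  exact: finite_synthesis_adjoint.
Qed.

(** On sequences supported far away, the coefficients <x, g_j> of finitely many
    generators are uniformly small, because the tails of the g_j are. *)
Lemma finite_coefficients_small n g e : (forall j, HA (g j)) -> 0 < e ->
  exists k0, forall k, (k0 <= k)%N -> forall x, Rsub k x ->
    hnorm (hcut 0 n (fun j => hinner x (g j))) <= e * hnorm x.
Proof.
move=> hg e0.
suff [k0 hk0] : exists k0, forall k, (k0 <= k)%N -> forall x, Rsub k x ->
    \sum_(0 <= j < n) nrm (hinner x (g j)) <= e * hnorm x.
  by exists k0 => k kk x rx; apply: le_trans (hnorm_hcut_coord _ _ _) (hk0 k kk x rx).
elim: n e e0 => [|n ih] e e0.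
  by exists 0%N => k _ x _; rewrite big_geq// mulr_ge0 ?(ltW e0) ?hnorm_ge0.
have e2 : 0 < e / 2 by rewrite divr_gt0.
have [N1 h1] := ih _ e2; have [N2 h2] := hcut_hlim (hg n) e2.
exists (maxn N1 N2) => k; rewrite geq_max => /andP[k1 k2] x rx.
rewrite big_nat_recr//=; have := h1 k k1 x rx.
suff : nrm (hinner x (g n)) <= e / 2 * hnorm x by lra.
have hx : HA x := rx.1; have hc : HA (hcut 0 k (g n)) by exact: HA_hcut.
have hd := HAB (hg n) hc.
have -> : hinner x (g n) = hinner x (g n - hcut 0 k (g n)).
  rewrite (hinnerBr hx (hg n) hc) -(hinnerC hc hx).
  by rewrite (Lsub_Rsub_orth (Lsub_hcut k (g n)) rx) star0 subr0.
apply: le_trans (cauchy_schwarz hx hd) _.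
by rewrite mulrC; apply: ler_wpM2r; [exact: hnorm_ge0 | exact: h2].
Qed.

(** A finitely generated closed submodule is the range of a finite synthesis
    operator, hence is complemented, and its projection p satisfies
    |p x|^2 = |<x, p x>| <= |G^* x| |c| for p x = G c with |c| <= C |p x|. *)
Lemma finitely_generated_projection N : closed_submodule N -> finitely_generated N ->
  exists p : (nat -> A) -> (nat -> A), [/\ (forall y, HA y -> N (p y)) /\
      (forall y, HA y -> horth N (y - p y)), Alinear_on HA p,
    forall y, HA y -> hnorm (p y) <= hnorm y,
    forall y, HA y -> hnorm (y - p y) <= hnorm y &
    forall e, 0 < e -> exists k0, forall k, (k0 <= k)%N -> forall x, Rsub k x ->
      hnorm (p x) <= e * hnorm x].
Proof.
move=> cN [n [g0 [Ng0 gen]]]; have [NH N0 ND NZ] := cN.1.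
(* the generators, continued by 0 past the index n *)
pose g j : nat -> A := oapp g0 0 (insub j).
have gE (i : 'I_n) : g i = g0 i by rewrite /g valK.
have Ng j : N (g j) by rewrite /g; case: insub.
have hg j : HA (g j) := NH _ (Ng j).
have BG := finite_synthesis_Ba n hg.
have NE : N = finite_synthesis n g @` (@HA R A).
  apply/seteqP; split => [x /gen[c xc]|_ [c _ <-]]; last first.
    have [h _] := @Alinear_sum _ _ N id n c g cN.1
      (conj (fun _ _ _ _ => erefl) (fun _ _ _ => erefl)) Ng.
    exact: h.
  exists (hcut 0 n (fun j => oapp c 0 (insub j))); first exact: HA_hcut.
  rewrite /finite_synthesis xc; apply: eq_bigr => i _.
  by rewrite gE /hcut /= ltn_ord valK.
have cG : closed_submodule (finite_synthesis n g @` (@HA R A)) by rewrite -NE.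
have [C C0 hC] := closed_range_preimage BG cG.
have [p [pN pO lp p1 p2]] : exists p : (nat -> A) -> (nat -> A), [/\ forall y, HA y -> N (p y),
    forall y, HA y -> horth N (y - p y), Alinear_on HA p,
    forall y, HA y -> hnorm (p y) <= hnorm y &
    forall y, HA y -> hnorm (y - p y) <= hnorm y].
  apply: orthogonal_projection => // y hy.
  by rewrite NE; exact: closed_range_complemented BG cG y hy.
exists p; split => // e e0.
have [k0 hk0] := finite_coefficients_small n hg (divr_gt0 e0 C0).
exists k0 => k kk x rx; have hx : HA x := rx.1; have hs := hk0 k kk x rx.
have Np := pN _ hx; have hp := NH _ Np; have [hxp oxp] := pO _ hx.
have [c [hc cp] cC] : exists2 v, HA v /\ finite_synthesis n g v = p x & hnorm v <= C * hnorm (p x).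
  by apply: hC; rewrite -NE.
have := hnorm_ge0 (p x); rewrite le_eqVlt => /orP[/eqP <-|p0].
  by rewrite mulr_ge0 ?(ltW e0) ?hnorm_ge0.
have hw : HA (hcut 0 n (fun j => hinner x (g j))) by exact: HA_hcut.
have E : hinner (p x) (p x) = hinner c (hcut 0 n (fun j => hinner x (g j))).
  rewrite -(finite_synthesis_adjoint n hg hc hx) cp.
  apply/eqP; rewrite -subr_eq0 -opprB oppr_eq0 -(hinnerBr hp hx hp); apply/eqP.
  by rewrite -(hinnerC hxp hp) (oxp _ Np) star0.
rewrite -(ler_pM2r p0) -expr2 hnorm_sqr E.
apply: le_trans (cauchy_schwarz hc hw) _.
apply: (@le_trans _ _ (C * hnorm (p x) * (e / C * hnorm x))).
  by apply: ler_pM => //; exact: hnorm_ge0.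
rewrite (_ : C * hnorm (p x) * (e / C * hnorm x) = e * hnorm x * hnorm (p x) * (C / C)); last by ring.
by rewrite divff ?mulr1// gt_eqF.
Qed.

(** Replace F on N1 by the embedding J of N1 into N2, N1^perp being used as the
    complement of N1: the operator E = F (1 - p) + J p is injective with a
    bound |x| <= B |E x|, because the M2-component of E x is that of
    F (1 - p) x. As p is small on L_k^perp for k large, E and F are close there,
    and |E l - F x| >= |l - x| / (2 B) for l in L_k and x in L_k^perp. *)
Lemma perturbed_lower_bound F : upper_semi_weyl F ->
  exists E : (nat -> A) -> (nat -> A), [/\ forall x, HA x -> HA (E x), Alinear_on HA E,
    bounded_on HA E & exists2 B : R, 0 < B & exists k0, forall k, (k0 <= k)%N ->
      forall l x, Lsub k l -> Rsub k x -> hnorm (l - x) <= B * hnorm (E l - F x)].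
Proof.
move=> [[FHA lF bF _] [M1 [N1 [M2 [N2 [d1 d2 [FM FN iF fg sub]]]]]]].
have [K K0 FK] := bounded_onP bF; have [FD FZ] := lF.
have FB x y : HA x -> HA y -> F (x - y) = F x - F y by exact: AlinearB HA_submodule lF.
have [cM1 cN1 _ s1] := d1; have [cM2 cN2 _ _] := d2.
have [M1H _ _ _] := cM1.1; have [N1H _ _ _] := cN1.1.
have [M2H _ _ _] := cM2.1; have [N2H _ N2D _] := cN2.1.
have [p [[pN pO] lp p1 p2 psmall]] := finitely_generated_projection cN1 fg.
have [pD pZ] := lp.
have [Q [cQ QN [J iJ]]] := sub; have [JQ lJ bJ _] := iJ; have [JD JZ] := lJ.
have [dJ dJ0 lowJ] := module_iso_bounded_below cN1.1 iJ.
have [KJ KJ0 JK] := bounded_onP bJ.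
have [dF dF0 lowF] := module_iso_bounded_below cM1.1 iF.
have [C C0 hC] := direct_sum_bounded d2.
pose E x := F (x - p x) + J (p x).
have wHA x : HA x -> HA (x - p x) by move=> hx; have [] := pO _ hx.
have JN2 x : N1 x -> N2 (J x) by move=> nx; apply: QN; exact: JQ.
have JHA x : N1 x -> HA (J x) by move=> nx; apply: N2H; exact: JN2.
have EHA x : HA x -> HA (E x).
  by move=> hx; apply: HAD; [apply: FHA; exact: wHA | apply: JHA; exact: pN].
have lE : Alinear_on HA E.
  split => [x y hx hy|a x hx]; rewrite /E.
    rewrite (pD _ _ hx hy) opprD addrACA (FD _ _ (wHA _ hx) (wHA _ hy)).
    by rewrite (JD _ _ (pN _ hx) (pN _ hy)) addrACA.
  rewrite (pZ _ _ hx) (JZ _ _ (pN _ hx)) hscaleDr -(FZ _ _ (wHA _ hx)).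
  by rewrite hscaleDr -(hscaleN1 (hscale _ _)) -(hscaleN1 (p x)) !hscaleA mulN1r mulrN1.
have bE : bounded_on HA E.
  exists (K + KJ) => x hx; have Np := pN _ hx; have hw := wHA _ hx.
  apply: le_trans (hnormD (FHA _ hw) (JHA _ Np)) _; rewrite mulrDl; apply: lerD.
    by apply: le_trans (FK _ hw) _; apply: ler_wpM2l (ltW K0) _ _ (p2 _ hx).
  by apply: le_trans (JK _ Np) _; apply: ler_wpM2l (ltW KJ0) _ _ (p1 _ hx).
have EB x y : HA x -> HA y -> E (x - y) = E x - E y by exact: AlinearB HA_submodule lE.
set D := dF * C; have D0 : 0 < D by rewrite mulr_gt0.
have Elow x : HA x -> hnorm x <= (D + dJ * (1 + K * D)) * hnorm (E x).
  move=> hx; have Np := pN _ hx; have hw := wHA _ hx; have [_ ow] := pO _ hx.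
  have hp := N1H _ Np.
  have [y1 My1 [y2 Ny2 y12]] : [set x + y | x in M1 & y in N1] (x - p x) by rewrite s1.
  have hy1 := M1H _ My1; have hy2 := N1H _ Ny2.
  have EE : E x = F y1 + (F y2 + J (p x)).
    by rewrite /E -y12 (FD _ _ hy1 hy2) addrA.
  have h1 : hnorm (F y1) <= C * hnorm (E x).
    by rewrite EE; apply: hC; [exact: FM | apply: N2D; [exact: FN | exact: JN2]].
  have h2 : hnorm y1 <= D * hnorm (E x).
    apply: le_trans (lowF _ My1) _; rewrite /D -mulrA.
    exact: ler_wpM2l (ltW dF0) _ _ h1.
  have h3 : hnorm (x - p x) <= hnorm y1.
    have -> : y1 = - y2 + (x - p x) by rewrite -y12 addrC addrK.
    apply: (hnorm_orth_le hw (HAN hy2) _).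
    by rewrite (hinnerNl hy2 hw) -(hinnerC hw hy2) (ow _ Ny2) star0 oppr0.
  have hE := EHA _ hx.
  have h4 : hnorm (J (p x)) <= hnorm (E x) + K * hnorm (x - p x).
    have -> : J (p x) = E x - F (x - p x) by rewrite /E addrC addKr.
    apply: le_trans (hnormB hE (FHA _ hw)) _; rewrite lerD2l.
    exact: FK.
  have h5 := lowJ _ Np.
  have h6 := hnormD hw hp; rewrite subrK in h6.
  have h7 := le_trans h3 h2.
  have h8 : K * hnorm (x - p x) <= K * (D * hnorm (E x)) := ler_wpM2l (ltW K0) h7.
  have h9 := le_trans h5 (ler_wpM2l (ltW dJ0) (le_trans h4 (lerD (lexx _) h8))).
  apply: le_trans h6 (le_trans (lerD h7 h9) _).
  by rewrite le_eqVlt; apply/orP; left; apply/eqP; ring.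
set B := D + dJ * (1 + K * D) in Elow.
have B0 : 0 < B by rewrite /B addr_gt0// mulr_gt0// addr_gt0// mulr_gt0.
exists E; split => //; exists (2 * B); first by rewrite mulr_gt0.
(* this bound on p makes |F x - E x| at most |x| / (2 B) on L_k^perp *)
have e0 : 0 < (2 * B * (K + KJ))^-1 by rewrite invr_gt0 !mulr_gt0// addr_gt0.
have [k0 hk0] := psmall _ e0; exists k0 => k kk l x ll rx.
have hl : HA l := ll.1; have hx : HA x := rx.1; have hlx := HAB hl hx.
have hpx := hk0 k kk x rx; have Np := pN _ hx; have hp := N1H _ Np.
have x_le : hnorm x <= hnorm (l - x).
  rewrite -(hnormN hx); apply: (hnorm_orth_le (HAN hx) hl _).
  by rewrite (hinnerNr hl hx) (Lsub_Rsub_orth ll rx) oppr0.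
have FE : hnorm (F x - E x) <= (2 * B)^-1 * hnorm (l - x).
  have -> : F x - E x = F (p x) - J (p x).
    by rewrite /E (FB _ _ hx hp) opprD addrA opprB [F x + _]addrC subrK.
  apply: le_trans (hnormB (FHA _ hp) (JHA _ Np)) _.
  apply: le_trans (lerD (FK _ hp) (JK _ Np)) _; rewrite -mulrDl.
  have KK : 0 < K + KJ by rewrite addr_gt0.
  apply: le_trans (ler_wpM2l (ltW KK) hpx) _; rewrite invfM mulrA mulrCA divff ?gt_eqF// mulr1.
  by apply: ler_wpM2l => //; rewrite invr_ge0 mulr_ge0// ltW.
have h1 := Elow _ hlx; rewrite (EB _ _ hl hx) in h1.
have hEl := EHA _ hl; have hEx := EHA _ hx; have hFx := FHA _ hx.
have h2 := hnorm_dist3 hEl hEx hFx.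
have h3 := le_trans h1 (ler_wpM2l (ltW B0) (le_trans h2 (lerD (lexx _) FE))).
have h4 : B * ((2 * B)^-1 * hnorm (l - x)) = 2^-1 * hnorm (l - x).
  by field; rewrite gt_eqF.
by move: h3; rewrite mulrDr h4; lra.
Qed.

(** For l in L_m the part of E l in X is some F x with x in L_m^perp, so the
    component of E l orthogonal to X is E l - F x, which is bounded below by l. *)
Lemma upper_semi_weyl_pseudo_riesz f : bessel f -> upper_semi_weyl (synthesis f) ->
  pseudo_riesz_weyl f.
Proof.
move=> hf wF; split => //.
have [E [EHA lE bE [B B0 [k0 hE]]]] := perturbed_lower_bound wF.
set F := synthesis f in wF hE; have BF : Ba F := synthesis_Ba hf.
have [FHA lF bF _] := BF.
(* the number m of removed terms has to be positive *)
set m := k0.+1; have hEm := hE m (leqnSn k0).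
exists m; set X := hclosure _; move=> /=.
set S := F \o hshift m; have BS : Ba S := Ba_shift m BF.
have [SHA lS bS [S' [S'HA SS']]] := BS.
have lowS x : HA x -> hnorm x <= B * hnorm (S x).
  move=> hx; have rs := Rsub_shift m hx.
  have L0 : Lsub m (0 : nat -> A) by case: (@Lsub_closed R A m) => -[].
  have := hEm _ _ L0 rs; rewrite (Alinear0 HA_submodule lE) !sub0r.
  by rewrite (hnormN rs.1) (hnorm_shift m hx) (hnormN (FHA _ rs.1)).
have [cS iS] := closed_image HA_closed lS bS SHA B0 lowS.
have XS : X = S @` (@HA R A) by exact: hclosure_span.
have XH : X `<=` HA by move=> x [].
have cX : closed_submodule X by rewrite XS.
split => //.
- exists S; split.
  + by rewrite XS.
  + by exists S'; split => [y Xy|x y hx Xy]; [apply: S'HA; exact: XH | apply: SS' => //; exact: XH].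
  + by move=> i; rewrite /S /= hshift_basis /F synthesis_basis.
have [Q [QX QO lQ _ Q2]] : exists Q : (nat -> A) -> (nat -> A), [/\ forall y, HA y -> X (Q y),
    forall y, HA y -> horth X (y - Q y), Alinear_on HA Q,
    forall y, HA y -> hnorm (Q y) <= hnorm y &
    forall y, HA y -> hnorm (y - Q y) <= hnorm y].
  apply: orthogonal_projection cX _ => y hy.
  by rewrite XS; exact: closed_range_complemented BS cS y hy.
have [ED EZ] := lE; have [QD QZ] := lQ.
apply: (@subisomorphic_bounded_below R A (Lsub m) (horth X) (fun l => E l - Q (E l)) B).
- exact: Lsub_closed.
- split => [x y [hx _] [hy _]|a x [hx _]].
    rewrite (ED _ _ hx hy) (QD _ _ (EHA _ hx) (EHA _ hy)) opprD.
    exact: addrACA.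
  rewrite (EZ _ _ hx) (QZ _ _ (EHA _ hx)) hscaleDr.
  by rewrite -(hscaleN1 (hscale _ _)) -(hscaleN1 (Q _)) !hscaleA mulN1r mulrN1.
- have [K hK] := bE; exists K => x [hx _]; apply: le_trans (Q2 _ (EHA _ hx)) _.
  exact: hK.
- by move=> x [hx _]; apply: QO; exact: EHA.
- by move=> x [].
- exact: B0.
- move=> l ll; have hl : HA l := ll.1; have := QX _ (EHA _ hl).
  rewrite {1}XS => -[z hz <-]; have rz := Rsub_shift m hz.
  apply: le_trans (hEm _ _ ll rz).
  have := hnorm_orth_le hl (HAN rz.1); rewrite addrC; apply.
  by rewrite (hinnerNl rz.1 hl) -(hinnerC hl rz.1) (Lsub_Rsub_orth ll rz) star0 oppr0.
Qed.

End Converse.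

Theorem proposition2p8 (R : realType) (A : cstarAlgType R)
    (f : nat -> nat -> A) (hf : bessel f) :
  pseudo_riesz_weyl f <-> upper_semi_weyl (synthesis f).
Proof.
split; first exact: synthesis_upper_semi_weyl.
exact: upper_semi_weyl_pseudo_riesz.
Qed.
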